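(* Let $G$ be a second-countable (Hausdorff) topological group. Then the following statements are equivalent. (1) $G$ is amenable. (2) $G$ admits a fully supported, regular Borel probability measure $\mu$ such that the Poisson boundary $\Pi_{\mu}(G)$ is trivial (i.e. a singleton). (3) $G$ admits a Borel probability measure $\mu$ such that the Poisson boundary $\Pi_{\mu}(G)$ is trivial (i.e. a singleton).
   Context: For a topological group $G$ and $g\in G$ let $\lambda_g\colon G\to G,\ x\mapsto gx$. A function $f\colon G\to\mathbb{C}$ is right-uniformly continuous if for every $\varepsilon>0$ there is a neighbourhood $U$ of the neutral element such that $|f(x)-f(y)|\le\varepsilon$ whenever $xy^{-1}\in U$. $\mathrm{RUCB}(G)$ is the commutative unital $C^*$-algebra of all bounded right-uniformly continuous functions $G\to\mathbb{C}$ (pointwise operations, supremum norm). $\mathrm{M}(G)$ is the set of states on $\mathrm{RUCB}(G)$ (positive linear functionals $\mu$ with $\mu(\mathbf 1)=1$). $G$ is amenable if there is $\mu\in\mathrm{M}(G)$ with $\mu(f\circ\lambda_g)=\mu(f)$ for all $f\in\mathrm{RUCB}(G)$, $g\in G$. A Borel probability measure $\mu$ on a Hausdorff space $T$ is regular if $\mu(B)=\sup\{\mu(K)\mid K\subseteq B,\ K\text{ compact}\}$ for every Borel set $B$; its support is $\mathrm{spt}(\mu)=\{x\in T\mid \mu(U)>0\text{ for every open }U\ni x\}$; it is fully supported if $\mathrm{spt}(\mu)=T$. The convolution of Borel probability measures $\mu,\nu$ on $G$ is $(\mu\nu)(B)=(\mu\otimes\nu)(\{(x,y)\in G\times G\mid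 xy\in B\})$ for $B\subseteq G$ Borel, and $\mu^n$ denotes the $n$-th convolution power. Given a Borel probability measure $\mu$ on the second-countable topological group $G$, put $(\Phi_{\mu}f)(g)=\int f(gx)\,d\mu(x)$ for $f\in\mathrm{RUCB}(G)$, $g\in G$ (then $\Phi_\mu f\in\mathrm{RUCB}(G)$), and let $\mathrm{H}_\mu(G)=\{f\in\mathrm{RUCB}(G)\mid \Phi_\mu f=f\}$ be the space of $\mu$-harmonic functions. $\mathrm{H}_\mu(G)$ is a commutative unital $C^*$-algebra with respect to the supremum norm, complex conjugation, and the multiplication $(f_1\cdot_\mu f_2)(g)=\lim_{n\to\infty}\Phi_{\mu^n}(f_1f_2)(g)$ (the limit exists for all $g\in G$). The Poisson boundary $\Pi_\mu(G)$ is the Gel'fand spectrum of this $C^*$-algebra, i.e. the compact Hausdorff space of (unital) ${}^*$-homomorphisms $\mathrm{H}_\mu(G)\to\mathbb{C}$ with the weak-${}^*$ topology. *)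

(* Defs.v *)
From HB Require Import structures.
From mathcomp Require Import all_boot all_order all_algebra.
From mathcomp Require Import complex.
From mathcomp Require Import all_classical all_reals all_analysis.
From mathcomp Require Import measurable_realfun.
Set Implicit Arguments.
Unset Strict Implicit.
Unset Printing Implicit Defensive.
Import Order.TTheory GRing.Theory Num.Theory.
Import numFieldNormedType.Exports.
Local Open Scope classical_set_scope.
Local Open Scope ring_scope.
Local Open Scope complex_scope.

(* The base point is only there because the measure-theory library asks for  *)
(* it; it is unrelated to the group structure.                               *)
HB.mixin Record PointedTopological_isTopologicalGroup G
    of Group G & PointedTopological G := {
  mulg_continuous : continuous (fun xy : G * G => (xy.1 * xy.2)%g) ;
  invg_continuous : continuous (fun x : G => (x^-1)%g) }.

#[short(type="topologicalGroupType")]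
HB.structure Definition TopologicalGroup :=
  { G of Group G & PointedTopological G
       & PointedTopological_isTopologicalGroup G }.

Definition borel (G : ptopologicalType) := g_sigma_algebraType (@open G).
HB.instance Definition _ (G : ptopologicalType) := Measurable.on (borel G).

(* The regular module R[i]^o, unlike R[i], carries the norm topology.        *)
Notation Cplx R := (R[i]^o).

Section RUCB.
Context (R : realType) (G : topologicalGroupType).
Implicit Types (f : G -> Cplx R) (g x y : G).

Definition right_uniformly_continuous f :=
  forall e : R, 0 < e ->
    exists2 U : set G, nbhs (1%g : G) U &
      forall x y, U (x * y^-1)%g -> `|f x - f y| <= e%:C.

Definition bounded_function f := exists M : R, forall x, `|f x| <= M%:C.

Definition rucb : {pred G -> Cplx R} :=
  [pred f | `[< bounded_function f /\ right_uniformly_continuous f >]].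

Lemma rucbP f :
  reflect (bounded_function f /\ right_uniformly_continuous f) (f \in rucb).
Proof. exact: asboolP. Qed.

End RUCB.

Section RUCB_closed.
Context (R : realType) (G : topologicalGroupType).
Implicit Types (f : G -> Cplx R) (g x y : G).

Lemma ge0_complexE (z : R[i]) : 0 <= z -> z = (complex.Re z)%:C.
Proof. by case: z => a b; rewrite lecE /= => /andP[/eqP -> _]. Qed.

Lemma bounded_functionP f :
  bounded_function f <-> exists2 M : R[i], 0 <= M & forall x, `|f x| <= M.
Proof.
split=> [[M fM]|[M M0 fM]].
  by exists M%:C => //; exact: le_trans (fM 1%g).
by exists (complex.Re M) => x; rewrite -ge0_complexE.
Qed.

Lemma right_uniformly_continuousP f :
  right_uniformly_continuous f <-> forall e : R[i], 0 < e ->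
    exists2 U : set G, nbhs (1%g : G) U &
      forall x y, U (x * y^-1)%g -> `|f x - f y| <= e.
Proof.
split=> uf e e0; last by apply: uf; rewrite ltcR.
have eE := ge0_complexE (ltW e0).
have [|U U1 Uf] := uf (complex.Re e); first by rewrite -ltcR -eE.
by exists U => // x y /Uf; rewrite -eE.
Qed.

Lemma rucb_cst (c : R[i]) : ((fun=> c) : G -> Cplx R) \in @rucb R G.
Proof.
apply/rucbP; split.
  by apply/bounded_functionP; exists `|c|.
move=> e e0; exists setT; first exact: filterT.
by move=> x y _; rewrite subrr normr0 ler0c ltW.
Qed.

Lemma rucb_conj f : f \in @rucb R G ->
  ((fun x => (f x)^*) : G -> Cplx R) \in @rucb R G.
Proof.
move=> /rucbP[[M fM] uf]; apply/rucbP; split.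
  by exists M => x; rewrite normcJ.
move=> e e0; have [U U1 Uf] := uf e e0.
by exists U => // x y /Uf; rewrite -rmorphB normcJ.
Qed.

Lemma mulgl_continuous g : continuous (fun x : G => (g * x)%g).
Proof.
move=> x; apply: (cvg_comp2 (cvg_cst g) cvg_id).
exact: (@mulg_continuous G (g, x)).
Qed.

Lemma mulgr_continuous g : continuous (fun x : G => (x * g)%g).
Proof.
move=> x; apply: (cvg_comp2 cvg_id (cvg_cst g)).
exact: (@mulg_continuous G (x, g)).
Qed.

Lemma rucb_ltrans g f : f \in @rucb R G ->
  ((fun x => f (g * x)%g) : G -> Cplx R) \in @rucb R G.
Proof.
move=> /rucbP[[M fM] uf]; apply/rucbP; split; first by exists M => x.
move=> e e0; have [U U1 Uf] := uf e e0.
exists [set u | U (g * u * g^-1)%g].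
  have cg : {for (1%g : G), continuous (fun u : G => (g * u * g^-1)%g)}.
    by apply: (@continuous_comp _ _ _ (fun u => g * u)%g (fun u => u * g^-1)%g);
      [exact: mulgl_continuous|exact: mulgr_continuous].
  by apply: cg; rewrite mulg1 mulgV.
move=> x y /=; have -> : (g * (x * y^-1) * g^-1 = (g * x) * (g * y)^-1)%g.
  by rewrite invgM !mulgA.
exact: Uf.
Qed.

Lemma rucb_submod_closed : submod_closed (@rucb R G).
Proof.
split=> [|a f1 f2]; first exact: rucb_cst.
move=> /rucbP[/bounded_functionP[M1 M10 fM1] /right_uniformly_continuousP u1].
move=> /rucbP[/bounded_functionP[M2 M20 fM2] /right_uniformly_continuousP u2].
apply/rucbP; split.
  apply/bounded_functionP; exists (`|a| * M1 + M2).
    by rewrite addr_ge0// mulr_ge0.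
  move=> x; apply: le_trans (ler_normD _ _) _.
  by rewrite lerD// normrM ler_wpM2l.
apply/right_uniformly_continuousP => e e0.
have a1 : 0 < `|a| + 1 by rewrite ltr_wpDl.
have [U1 U11 Uf1] := u1 (e / 2 / (`|a| + 1)) ltac:(by rewrite !divr_gt0).
have [U2 U21 Uf2] := u2 (e / 2) ltac:(by rewrite divr_gt0).
exists (U1 `&` U2); first exact: filterI.
move=> x y [/Uf1 h1 /Uf2 h2].
have -> : (a *: f1 + f2) x - (a *: f1 + f2) y =
    a * (f1 x - f1 y) + (f2 x - f2 y).
  by rewrite mulrBr opprD addrACA.
apply: le_trans (ler_normD _ _) _.
rewrite [leRHS](splitr e) lerD// normrM.
apply: le_trans (ler_wpM2l (normr_ge0 _) h1) _.
rewrite mulrCA ler_piMr ?divr_ge0 ?(ltW e0)//.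
by rewrite ler_pdivrMr// mul1r lerDl.
Qed.

Lemma rucb_continuous f : f \in @rucb R G -> continuous f.
Proof.
move=> /rucbP[_ /right_uniformly_continuousP uf] x.
apply/cvgrPdist_le => e e0; have [U U1 Uf] := uf e e0.
have : \forall y \near x, U (y * x^-1)%g.
  by apply: mulgr_continuous; rewrite mulgV.
by apply: filterS => y /Uf; rewrite distrC.
Qed.

End RUCB_closed.

Record RUCB (R : realType) (G : topologicalGroupType) := MkRUCB {
  RUCB_fun :> G -> Cplx R ;
  _ : RUCB_fun \in @rucb R G }.

Section RUCB_type.
Context (R : realType) (G : topologicalGroupType).

HB.instance Definition _ := [isSub for @RUCB_fun R G].
HB.instance Definition _ := [Choice of RUCB R G by <:].
HB.instance Definition _ := GRing.SubChoice_isSubLmodule.Build R[i]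
  (G -> Cplx R) (@rucb R G) (RUCB R G) (rucb_submod_closed R G).

Definition RUCB_one : RUCB R G := MkRUCB (rucb_cst G 1).

Definition RUCB_conj (f : RUCB R G) : RUCB R G := MkRUCB (rucb_conj (valP f)).

Definition RUCB_ltrans (g : G) (f : RUCB R G) : RUCB R G :=
  MkRUCB (rucb_ltrans g (valP f)).

Definition means : set (RUCB R G -> R[i]) :=
  [set m | [/\ scalar m,
               forall f : RUCB R G, (forall x, 0 <= f x) -> 0 <= m f &
               m RUCB_one = 1]].

End RUCB_type.

Definition amenable (R : realType) (G : topologicalGroupType) :=
  exists2 m : RUCB R G -> R[i], means m &
    forall (f : RUCB R G) (g : G), m (RUCB_ltrans g f) = m f.

Section measures.
Context (R : realType) (G : topologicalGroupType).
Implicit Types mu nu : set (borel G) -> \bar R.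

Definition regular_measure mu :=
  forall B : set (borel G), measurable B ->
    mu B = ereal_sup [set mu K | K in [set K : set G | K `<=` B /\ compact K]].

Definition spt mu : set G :=
  [set x | forall U : set G, open U -> U x -> (0 < mu U)%E].

Definition fully_supported mu := spt mu = setT.

(* Convolutions are set functions, not bundled measures: that multiplication *)
(* is measurable for the product sigma-algebra uses second countability.     *)
Definition convolution mu nu : set (borel G) -> \bar R :=
  pushforward (mu \x nu)%E
    (fun xy : borel G * borel G => (xy.1 * xy.2)%g : borel G).

(* The zeroth power is the Dirac mass at the neutral element, so the first   *)
(* power agrees with mu on Borel sets.                                       *)
Definition convolution_power mu (n : nat) : set (borel G) -> \bar R :=
  iter n (convolution mu) (\d_ (1%g : borel G)).

Definition cintegral mu (F : G -> Cplx R) : Cplx R :=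
  fine (\int[mu]_(x in [set: borel G]) (complex.Re (F x))%:E)%E +i*
  fine (\int[mu]_(x in [set: borel G]) (complex.Im (F x))%:E)%E.

Definition Phi mu (f : G -> Cplx R) : G -> Cplx R :=
  fun g => cintegral mu (fun x => f (g * x)%g).

End measures.

Section harmonic.
Context (R : realType) (G : topologicalGroupType).
Variable mu : probability (borel G) R.

Lemma normc_ge_Im (z : R[i]) : `|complex.Im z|%:C <= `|z|.
Proof.
by case: z => a b; simpc; rewrite -sqrtr_sqr ler_wsqrtr // lerDr sqr_ge0.
Qed.

Lemma rucb_integrable (f : G -> Cplx R) (p : R[i] -> R) :
  (forall z w, p (z - w) = p z - p w) -> (forall z, `|p z|%:C <= `|z|) ->
  f \in @rucb R G ->
  mu.-integrable [set: borel G] (EFin \o (fun x => p (f x))).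
Proof.
move=> pB pn fu; apply: measurable_bounded_integrable => //.
- by apply: le_lt_trans (ltry 1); rewrite probability_le1.
- have cpf : continuous (fun x : G => p (f x)).
    move=> x; apply/cvgrPdist_le => e e0.
    have fx : f y @[y --> x] --> f x by exact: rucb_continuous.
    move/cvgrPdist_le : fx => /(_ e%:C); rewrite ltcR => /(_ e0).
    apply: filterS => y fxy.
    by rewrite -pB -lecR; exact: le_trans (pn _) fxy.
  apply: (measurability _ (RGenOpens.measurableE R)).
  move=> _ [_ [a [b ->]] <-]; rewrite setTI.
  apply: sub_sigma_algebra.
  by move/continuousP : cpf; apply; exact: interval_open.
- move: fu => /rucbP[[M fM] _]; exists M; split; first exact: num_real.
  move=> N MN x _ /=; rewrite (le_trans _ (ltW MN))// -lecR.
  exact: le_trans (pn _) (fM x).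
Qed.

Lemma cintegralE (F : G -> Cplx R) : cintegral mu F =
  (\int[mu]_(x in [set: borel G]) complex.Re (F x)) +i*
  (\int[mu]_(x in [set: borel G]) complex.Im (F x)).
Proof. by []. Qed.

Lemma cintegralZD (f1 f2 : G -> Cplx R) (a : R[i]) :
  f1 \in @rucb R G -> f2 \in @rucb R G ->
  cintegral mu (fun x => a * f1 x + f2 x) =
  a * cintegral mu f1 + cintegral mu f2.
Proof.
move=> r1 r2.
have ReI f : f \in @rucb R G -> mu.-integrable [set: borel G]
    (EFin \o (fun x => complex.Re (f x))).
  by apply: rucb_integrable; [move=> [? ?] [? ?]|exact: normc_ge_Re].
have ImI f : f \in @rucb R G -> mu.-integrable [set: borel G]
    (EFin \o (fun x => complex.Im (f x))).
  by apply: rucb_integrable; [move=> [? ?] [? ?]|exact: normc_ge_Im].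
have ZI c f : mu.-integrable [set: borel G] (EFin \o f) ->
    mu.-integrable [set: borel G] (EFin \o (fun x => c * f x)).
  by move=> fI; rewrite (_ : _ \o _ = fun x => c%:E * (f x)%:E)%E//;
    exact: integrableZl.
have DI (f g : borel G -> R) : mu.-integrable [set: borel G] (EFin \o f) ->
    mu.-integrable [set: borel G] (EFin \o g) ->
    mu.-integrable [set: borel G] (EFin \o (fun x => f x + g x)).
  by move=> fI gI; rewrite (_ : _ \o _ = fun x => (f x)%:E + (g x)%:E)%E//;
    exact: integrableD.
case: a => a b.
have {}ReE x : complex.Re ((a +i* b) * f1 x + f2 x) =
    a * complex.Re (f1 x) + (- b) * complex.Im (f1 x) + complex.Re (f2 x).
  by case: (f1 x) => ? ?; case: (f2 x) => ? ? /=; rewrite mulNr.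
have {}ImE x : complex.Im ((a +i* b) * f1 x + f2 x) =
    a * complex.Im (f1 x) + b * complex.Re (f1 x) + complex.Im (f2 x).
  by case: (f1 x) => ? ?; case: (f2 x) => ? ? /=.
rewrite !cintegralE.
under [X in X +i* _]eq_Rintegral do rewrite ReE.
under [X in _ +i* X]eq_Rintegral do rewrite ImE.
rewrite !RintegralD ?RintegralZl//; try by [
  exact: ReI | exact: ImI | exact/ZI/ReI | exact/ZI/ImI |
  apply: DI; first [exact/ZI/ReI | exact/ZI/ImI]].
by apply/eqP; rewrite eq_complex /= mulNr !eqxx.
Qed.

Lemma cintegral_cst (c : R[i]) : cintegral mu (fun=> c) = c.
Proof.
rewrite !cintegralE !Rintegral_cst// (_ : fine _ = 1) ?mulr1; last first.
  by rewrite [X in fine X]probability_setT.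
by case: c.
Qed.

Lemma cintegral_conj (f : G -> Cplx R) : f \in @rucb R G ->
  cintegral mu (fun x => (f x)^*) = (cintegral mu f)^*.
Proof.
move=> fu; rewrite !cintegralE /=; apply/eqP; rewrite eq_complex /=.
apply/andP; split; apply/eqP.
  by apply: eq_Rintegral => x _; case: (f x).
rewrite -mulN1r -RintegralZl//.
  by apply: eq_Rintegral => x _; case: (f x) => ? ?; rewrite mulN1r.
by apply: rucb_integrable => //; [move=> [? ?] [? ?]|exact: normc_ge_Im].
Qed.

Definition is_harmonic : {pred RUCB R G} :=
  [pred f : RUCB R G | `[< Phi mu f = f :> (G -> Cplx R) >]].

Lemma is_harmonicP (f : RUCB R G) :
  reflect (Phi mu f = f :> (G -> Cplx R)) (f \in is_harmonic).
Proof. exact: asboolP. Qed.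

Lemma is_harmonic_submod_closed : submod_closed is_harmonic.
Proof.
split=> [|a f1 f2 /is_harmonicP h1 /is_harmonicP h2].
  by apply/is_harmonicP/funext => g; exact: cintegral_cst.
apply/is_harmonicP/funext => g.
rewrite /Phi [LHS]cintegralZD; last 2 first.
- exact: (rucb_ltrans g (valP f1)).
- exact: (rucb_ltrans g (valP f2)).
by rewrite -!/(Phi _ _ g) h1 h2.
Qed.

Lemma is_harmonic_one : RUCB_one R G \in is_harmonic.
Proof. by apply/is_harmonicP/funext => g; exact: cintegral_cst. Qed.

Lemma is_harmonic_conj (f : RUCB R G) :
  f \in is_harmonic -> RUCB_conj f \in is_harmonic.
Proof.
move=> /is_harmonicP fh; apply/is_harmonicP/funext => g.
rewrite /Phi [LHS](cintegral_conj (rucb_ltrans g (valP f))).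
by rewrite -/(Phi _ _ g) fh.
Qed.

End harmonic.

Record harmonic_fun (R : realType) (G : topologicalGroupType)
    (mu : probability (borel G) R) := MkHarmonic {
  harmonic_RUCB :> RUCB R G ;
  _ : harmonic_RUCB \in is_harmonic mu }.

Section poisson_boundary.
Context (R : realType) (G : topologicalGroupType).
Variable mu : probability (borel G) R.

HB.instance Definition _ := [isSub for @harmonic_RUCB R G mu].
HB.instance Definition _ := [Choice of harmonic_fun mu by <:].
HB.instance Definition _ := GRing.SubChoice_isSubLmodule.Build R[i]
  (RUCB R G) (is_harmonic mu) (harmonic_fun mu) (is_harmonic_submod_closed mu).

Definition harmonic_one : harmonic_fun mu := MkHarmonic (is_harmonic_one mu).

Definition harmonic_conj (f : harmonic_fun mu) : harmonic_fun mu :=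
  MkHarmonic (is_harmonic_conj (valP f)).

(* h is the product of f1 and f2 in the algebra of harmonic functions. The   *)
(* product is given by its graph: that the limit exists and is harmonic is a *)
(* theorem (for second-countable G), not part of the definition.             *)
Definition is_harmonic_mul (f1 f2 h : harmonic_fun mu) :=
  forall g : G,
    Phi (convolution_power mu n) (fun x => f1 x * f2 x) g @[n --> \oo] --> h g.

(* The Gel'fand spectrum, as a subset of the space of functions              *)
(* harmonic_fun mu -> Cplx R; the topology of pointwise convergence of the   *)
(* latter induces the weak-* topology.                                       *)
Definition poisson_boundary : set (harmonic_fun mu -> Cplx R) :=
  [set chi | [/\ scalar chi,
                 chi harmonic_one = 1,
                 forall f, chi (harmonic_conj f) = (chi f)^* &
                 forall f1 f2 h, is_harmonic_mul f1 f2 h ->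
                   chi h = chi f1 * chi f2]].

Definition trivial_poisson_boundary := exists chi, poisson_boundary = [set chi].

End poisson_boundary.

(* Main.v *)
Require Import Defs.
From HB Require Import structures.
From mathcomp Require Import all_boot all_order all_algebra.
From mathcomp Require Import complex.
From mathcomp Require Import all_classical all_reals all_analysis.
From mathcomp Require Import measurable_realfun.
From mathcomp Require Import ring lra.
Set Implicit Arguments.
Unset Strict Implicit.
Unset Printing Implicit Defensive.
Import Order.TTheory GRing.Theory Num.Theory.
Import numFieldNormedType.Exports.
Local Open Scope classical_set_scope.
Local Open Scope ring_scope.
Local Open Scope complex_scope.

(* From a harmonic f and c < f g one gets a point of the boundary at which f  *)
(* is at least c, as the limit along an ultrafilter on G that contains        *)
(* {|a| < e} whenever Phi^n (|a| u) (g) tends to 0, where u = (f - c)^+. Such *)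
(* limits are multiplicative because Phi^n |f1 f2 - f1 . f2| tends to 0. So a *)
(* trivial boundary forces harmonic functions to be constant, and then the    *)
(* limit of the Cesaro means of Phi^n f along an ultrafilter on nat is a      *)
(* harmonic function, whose constant value is an invariant mean of f.         *)
(*                                                                            *)
(* Conversely, let G be amenable, and let H be the set of functions bounded   *)
(* by 1 that are 1-Lipschitz for a pseudometric of the right uniformity.      *)
(* Hahn-Banach in the bounded functions on H (Day's trick) yields finitely    *)
(* supported probabilities w i that are almost invariant uniformly on H under *)
(* any prescribed finite set. As in Kaimanovich-Vershik, take                 *)
(* mu = sum_i 2^-(i+1) w i, where w i is almost invariant under short         *)
(* products of atoms of the earlier w j. For the random walk of law mu,       *)
(* stopped at the first increment drawn from some w i with i >= K, the mean   *)
(* of a harmonic f is almost independent of the starting point; hence f is    *)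
(* constant.                                                                  *)

(** * Bounded right uniformly continuous functions *)

(** The link between amenability and the boundary is the Liouville property: every real RUCB
    function fixed by [Phir mu] is constant. [trivial_boundary_harmonic] and
    [harmonic_cst_trivial_boundary] show that it amounts to triviality of the boundary. The former
    needs enough characters: [boundary_ultrafilter] and [boundary_pointP] supply them, and their
    multiplicativity rests on [harmonic_mul].

    From Liouville to amenability ([liouville_amenable]), the mean is the constant value of an
    ultralimit of Cesaro means. Dominated convergence handles sequences only, so
    [ultralimit_subsequence] is needed to see that this ultralimit is harmonic.

    From amenability to Liouville ([amenable_liouville]), [lipschitz1_almost_invariant] turns an
    invariant mean into finitely supported, almost invariant weights. They are combined so that a
    long walk very probably makes a step whose law is almost invariant under everything walked
    before; such a step forgets the starting point, whence [harmonic_eq_at_dense]. A dense sequence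
    among the atoms gives full support, and a countable sum of point masses is regular.

    Complex functions are handled through their real and imaginary parts. *)

Section real_rucb.
Context (R : realType) (G : topologicalGroupType).
Implicit Types (f F : G -> R) (U : set G).

Definition has_modulus f U (e : R) :=
  forall x y, U (x * y^-1)%g -> `|f x - f y| <= e.

Definition bounded_by f (M : R) := forall x, `|f x| <= M.

Definition rucbr f := (exists M, bounded_by f M) /\
  forall e, 0 < e -> exists2 U, nbhs (1%g : G) U & has_modulus f U e.

(** The functions controlled by a fixed [f] in RUCB are uniformly bounded and equicontinuous. They
    include its iterates under [Phir] and its Cesaro means, and pointwise limits of controlled
    functions along proper filters are controlled again. *)
Definition controls f F := (forall M, bounded_by f M -> bounded_by F M) /\
  (forall U e, has_modulus f U e -> has_modulus F U e).

Lemma controls_rucbr f F : controls f F -> rucbr f -> rucbr F.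
Proof.
move=> [bF mF] [[M fM] uf]; split; first by exists M; exact: bF.
by move=> e /uf[U U1 fU]; exists U => //; exact: mF.
Qed.

Lemma controls_refl f : controls f f.
Proof. by []. Qed.

Lemma controls_trans f F1 F2 : controls f F1 -> controls F1 F2 -> controls f F2.
Proof. by move=> [b1 m1] [b2 m2]; split=> *; [exact/b2/b1|exact/m2/m1]. Qed.

Lemma controls_norm f : controls f (fun x => `|f x|).
Proof.
split=> [M fM x|U e fU x y /fU]; first by rewrite normr_id.
exact/le_trans/ler_dist_dist.
Qed.

Lemma controls_lim (T : Type) (V : set_system T) (FV : ProperFilter V)
    f (u : T -> G -> R) F :
  (forall n, controls f (u n)) -> (forall x, u n x @[n --> V] --> F x) ->
  controls f F.
Proof.
move=> cu uF; split=> [M fM x|U e fU x y Uxy].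
  have : `|u n x| @[n --> V] --> `|F x| by apply: cvg_norm; exact: uF.
  by move/cvgr_to_le; apply; apply: nearW => n; exact: (cu n).1.
have : `|u n x - u n y| @[n --> V] --> `|F x - F y|.
  by apply: cvg_norm; apply: cvgB; exact: uF.
by move/cvgr_to_le; apply; apply: nearW => n; exact: (cu n).2 fU _ _ Uxy.
Qed.

Lemma rucbr_cst (c : R) : rucbr (fun=> c).
Proof.
split; first by exists `|c|.
move=> e e0; exists setT; first exact: filterT.
by move=> x y _; rewrite subrr normr0 ltW.
Qed.

Lemma rucbrD f F : rucbr f -> rucbr F -> rucbr (fun x => f x + F x).
Proof.
move=> [[M fM] uf] [[N FN] uF]; split.
  by exists (M + N) => x; rewrite (le_trans (ler_normD _ _))// lerD.
move=> e e0; have e2 : 0 < e / 2 by rewrite divr_gt0.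
have [U U1 Uf] := uf _ e2; have [V V1 VF] := uF _ e2.
exists (U `&` V); first exact: filterI.
move=> x y [Uxy Vxy]; rewrite opprD addrACA (le_trans (ler_normD _ _))//.
by rewrite [leRHS]splitr lerD ?Uf ?VF.
Qed.

Lemma rucbrM f F : rucbr f -> rucbr F -> rucbr (fun x => f x * F x).
Proof.
move=> [[M fM] uf] [[N FN] uF].
have M0 : 0 <= M by rewrite (le_trans _ (fM 1%g)).
have N0 : 0 <= N by rewrite (le_trans _ (FN 1%g)).
split; first by exists (M * N) => x; rewrite normrM ler_pM.
move=> e e0.
have e2 : 0 < e / (M + N + 1) by rewrite divr_gt0// ltr_wpDl// addr_ge0.
have [U U1 Uf] := uf _ e2; have [V V1 VF] := uF _ e2.
exists (U `&` V); first exact: filterI.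
move=> x y [/Uf Uxy /VF Vxy].
have -> : f x * F x - f y * F y = (f x - f y) * F x + f y * (F x - F y) by ring.
rewrite (le_trans (ler_normD _ _))// !normrM.
apply: (@le_trans _ _ (e / (M + N + 1) * N + M * (e / (M + N + 1)))).
  by rewrite lerD// ler_pM.
have -> : e / (M + N + 1) * N + M * (e / (M + N + 1)) =
   e * ((M + N) / (M + N + 1)) by ring.
rewrite ler_piMr ?(ltW e0)// ler_pdivrMr ?mul1r ?lerDl//.
by rewrite ltr_wpDl// addr_ge0.
Qed.

Lemma rucbrZ (a : R) f : rucbr f -> rucbr (fun x => a * f x).
Proof. exact: rucbrM (rucbr_cst a). Qed.

Lemma rucbrN f : rucbr f -> rucbr (fun x => - f x).
Proof.
by move=> /(rucbrZ (-1)); congr rucbr; apply/funext => x; rewrite mulN1r.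
Qed.

Lemma rucbrB f F : rucbr f -> rucbr F -> rucbr (fun x => f x - F x).
Proof. by move=> rf /rucbrN; exact: rucbrD. Qed.

Lemma rucbr_norm f : rucbr f -> rucbr (fun x => `|f x|).
Proof. exact/controls_rucbr/controls_norm. Qed.

Lemma rucbr_continuous f : rucbr f -> continuous f.
Proof.
move=> [_ uf] x; apply/cvgrPdist_le => e e0; have [U U1 Uf] := uf e e0.
have : \forall y \near x, U (y * x^-1)%g.
  by apply: mulgr_continuous; rewrite mulgV.
by apply: filterS => y /Uf; rewrite distrC.
Qed.

Lemma rucbr_measurable f : rucbr f ->
  measurable_fun [set: borel G] (f : borel G -> R).
Proof.
move=> /rucbr_continuous cf.
apply: (measurability _ (RGenOpens.measurableE R)).
move=> _ [_ [a [b ->]] <-]; rewrite setTI; apply: sub_sigma_algebra.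
by move/continuousP : cf; apply; exact: interval_open.
Qed.

Lemma rucbr_ltrans g f : rucbr f -> rucbr (fun x => f (g * x)%g).
Proof.
move=> [[M fM] uf]; split; first by exists M => x.
move=> e e0; have [U U1 Uf] := uf e e0.
exists [set u | U (g * u * g^-1)%g].
  have cg : {for (1%g : G), continuous (fun u : G => (g * u * g^-1)%g)}.
    by apply: (@continuous_comp _ _ _ (fun u => g * u)%g (fun u => u * g^-1)%g);
      [exact: mulgl_continuous|exact: mulgr_continuous].
  by apply: cg; rewrite mulg1 mulgV.
move=> x y /=; have -> : (g * (x * y^-1) * g^-1 = (g * x) * (g * y)^-1)%g.
  by rewrite invgM !mulgA.
exact: Uf.
Qed.

End real_rucb.

(** * The averaging operator on real functions and its iterates *)

Section convolution_operator.
Context (R : realType) (G : topologicalGroupType).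
Implicit Types (mu : probability (borel G) R) (f F : G -> R) (g : G).

Definition Phir (mu : probability (borel G) R) f : G -> R :=
  fun g => \int[mu]_(x in [set: borel G]) f (g * x)%g.

Lemma rucbr_integrable mu f : rucbr f ->
  mu.-integrable [set: borel G] (EFin \o f).
Proof.
move=> rf; apply: measurable_bounded_integrable => //.
- by apply: le_lt_trans (ltry 1); rewrite probability_le1.
- exact: rucbr_measurable.
- have [[M fM] _] := rf; exists M; split; first exact: num_real.
  by move=> N MN x _ /=; rewrite (le_trans (fM x)) ?ltW.
Qed.

Let integrable_ltrans mu f g : rucbr f ->
  mu.-integrable [set: borel G] (EFin \o (fun x => f (g * x)%g)).
Proof. by move=> rf; apply: rucbr_integrable; exact: rucbr_ltrans. Qed.

Lemma Phir_cst mu c : Phir mu (fun=> c) = fun=> c.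
Proof.
apply/funext => g; rewrite /Phir Rintegral_cst// (_ : fine _ = 1) ?mulr1//.
by rewrite [X in fine X]probability_setT.
Qed.

Lemma PhirD mu f F : rucbr f -> rucbr F ->
  Phir mu (fun x => f x + F x) = fun x => Phir mu f x + Phir mu F x.
Proof.
move=> rf rF; apply/funext => g.
by rewrite /Phir RintegralD//; exact: integrable_ltrans.
Qed.

Lemma PhirZ mu a f : rucbr f ->
  Phir mu (fun x => a * f x) = fun x => a * Phir mu f x.
Proof.
move=> rf; apply/funext => g.
by rewrite /Phir RintegralZl//; exact: integrable_ltrans.
Qed.

Lemma PhirB mu f F : rucbr f -> rucbr F ->
  Phir mu (fun x => f x - F x) = fun x => Phir mu f x - Phir mu F x.
Proof.
move=> rf rF; apply/funext => g.
by rewrite /Phir RintegralB//; exact: integrable_ltrans.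
Qed.

Lemma le_Phir mu f F g : rucbr f -> rucbr F -> (forall x, f x <= F x) ->
  Phir mu f g <= Phir mu F g.
Proof.
move=> rf rF fF; apply: le_Rintegral => //; exact: integrable_ltrans.
Qed.

Lemma le_norm_Phir mu f g : rucbr f ->
  `|Phir mu f g| <= Phir mu (fun x => `|f x|) g.
Proof.
by move=> rf; apply: le_normr_Rintegral => //; exact: integrable_ltrans.
Qed.

Lemma Phir_controls mu f : rucbr f -> controls f (Phir mu f).
Proof.
move=> rf; split=> [M fM g|U e fU g h Ugh].
  rewrite (le_trans (le_norm_Phir _ _ rf))//.
  have := @Phir_cst mu M; move=> /(congr1 (fun F => F g)) <-.
  by apply: le_Phir => //; [exact: rucbr_norm|exact: rucbr_cst].
rewrite /Phir -RintegralB//; [|exact: integrable_ltrans..].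
have rD : rucbr (fun x => f (g * x)%g - f (h * x)%g).
  by apply: rucbrB; exact: rucbr_ltrans.
rewrite (le_trans (le_normr_Rintegral _ _))//; first exact: rucbr_integrable.
have := @Phir_cst mu e; move=> /(congr1 (fun F => F g)) <-.
apply: le_Rintegral => //.
- by apply: rucbr_integrable; exact: rucbr_norm.
- by apply: rucbr_integrable; exact: rucbr_cst.
(* Since (g x)(h x)^-1 = g h^-1, right translates keep the modulus of [f]. *)
- by move=> x _; apply: fU; rewrite invgM mulgA mulgK.
Qed.

Lemma rucbr_Phir mu f : rucbr f -> rucbr (Phir mu f).
Proof. by move=> rf; exact: controls_rucbr (Phir_controls mu rf) rf. Qed.

Lemma iter_Phir_controls mu f n : rucbr f -> controls f (iter n (Phir mu) f).
Proof.
move=> rf; elim: n => [|n IH]; first exact: controls_refl.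
apply: (controls_trans IH); apply: Phir_controls.
exact: controls_rucbr IH rf.
Qed.

Lemma rucbr_iter mu f n : rucbr f -> rucbr (iter n (Phir mu) f).
Proof. by move=> rf; exact: controls_rucbr (iter_Phir_controls mu n rf) rf. Qed.

Lemma iter_Phir_cst mu c n : iter n (Phir mu) (fun=> c) = fun=> c.
Proof. by elim: n => //= n ->; rewrite Phir_cst. Qed.

Lemma iter_PhirD mu f F n : rucbr f -> rucbr F ->
  iter n (Phir mu) (fun x => f x + F x) =
  fun x => iter n (Phir mu) f x + iter n (Phir mu) F x.
Proof.
by move=> rf rF; elim: n => //= n ->; rewrite PhirD//; exact: rucbr_iter.
Qed.

Lemma iter_PhirZ mu a f n : rucbr f ->
  iter n (Phir mu) (fun x => a * f x) = fun x => a * iter n (Phir mu) f x.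
Proof.
by move=> rf; elim: n => //= n ->; rewrite PhirZ//; exact: rucbr_iter.
Qed.

Lemma iter_PhirB mu f F n : rucbr f -> rucbr F ->
  iter n (Phir mu) (fun x => f x - F x) =
  fun x => iter n (Phir mu) f x - iter n (Phir mu) F x.
Proof.
by move=> rf rF; elim: n => //= n ->; rewrite PhirB//; exact: rucbr_iter.
Qed.

Lemma le_iter_Phir mu f F n g : rucbr f -> rucbr F -> (forall x, f x <= F x) ->
  iter n (Phir mu) f g <= iter n (Phir mu) F g.
Proof.
move=> rf rF fF; elim: n g => //= n IH g.
by apply: le_Phir => //; exact: rucbr_iter.
Qed.

(** Dominated convergence: the bound inherited from [f] is the dominating constant. *)
Lemma Phir_cvg mu f (u : nat -> G -> R) F : rucbr f ->
  (forall n, controls f (u n)) -> (forall x, u n x @[n --> \oo] --> F x) ->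
  forall g, Phir mu (u n) g @[n --> \oo] --> Phir mu F g.
Proof.
move=> rf cu uF g.
have cF : controls f F by apply: controls_lim uF => //.
have [[M fM] _] := rf.
have ru n : rucbr (u n) := controls_rucbr (cu n) rf.
have rF := controls_rucbr cF rf.
have := @dominated_cvg _ _ _ mu [set: borel G] measurableT
  (fun n => EFin \o (fun x => u n (g * x)%g)) (EFin \o (fun x => F (g * x)%g))
  (EFin \o (fun=> M)).
move=> /(_ (fun n => measurable_int _ (integrable_ltrans mu g (ru n)))).
have -> : ((\int[mu]_x (EFin \o (fun x => F (g * x)%g)) x) =
   (Phir mu F g)%:E)%E.
  rewrite /Phir /Rintegral fineK//.
  exact: (integrable_fin_num measurableT (integrable_ltrans _ _ _)).
have -> : (fun n => \int[mu]_x (EFin \o (fun x => u n (g * x)%g)) x)%E =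
   EFin \o (fun n => Phir mu (u n) g).
  apply/funext => n /=.
  rewrite /Phir /Rintegral fineK//.
  exact: (integrable_fin_num measurableT (integrable_ltrans _ _ _)).
move=> H; suff /fine_cvgP[] :
  (EFin \o (fun n => Phir mu (u n) g)) @ \oo --> (Phir mu F g)%:E by [].
apply: H => //.
- by move=> x _; apply: cvg_EFin; [exact: nearW|exact: uF].
- by apply: rucbr_integrable; exact: rucbr_cst.
- by move=> n x _ /=; rewrite lee_fin; exact: (cu n).1.
Qed.

End convolution_operator.

(** * Convolution powers *)

Lemma countable_bigcup_measurable d (T : measurableType d) I (D : set I)
    (F : I -> set T) : countable D -> (forall i, D i -> measurable (F i)) ->
  measurable (\bigcup_(i in D) F i).
Proof.
move=> /pfcard_geP[->|[h] mF]; first by rewrite bigcup_set0.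
rewrite -(image_eq h) bigcup_image; apply: bigcupT_measurable => n.
by apply: mF; exact: funS.
Qed.

Section convolution_powers.
Context (R : realType) (G : topologicalGroupType).
Hypothesis countableG : @second_countable G.
Implicit Types (mu nu : probability (borel G) R) (f : G -> R).

(** By second countability the preimage of an open set is a countable union of products of basic
    open sets, hence lies in the product of the Borel sigma-algebras. *)
Lemma measurable_mulg : measurable_fun [set: borel G * borel G]
  (fun xy : borel G * borel G => (xy.1 * xy.2)%g : borel G).
Proof.
have [B cB [Bo nB]] := countableG.
have mE : @measurable _ (borel G) = <<s @open G >> by [].
apply: (measurability _ mE).
move=> _ [W oW <-].
rewrite setTI.
pose D := [set UV : set G * set G | [/\ B UV.1, B UV.2 &
   UV.1 `*` UV.2 `<=` (fun xy : G * G => (xy.1 * xy.2)%g) @^-1` W]].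
have cD : countable D.
  apply: (@sub_countable _ _ _ (B `*` B)); last exact: countableX.
  by apply: subset_card_le => -[U V] [].
have -> : (fun xy : borel G * borel G => (xy.1 * xy.2)%g) @^-1` W =
    \bigcup_(UV in D) (UV.1 `*` UV.2).
  apply/seteqP; split=> [[x y] /= Wxy|[x y] [[U V] [_ _ UVW]] /UVW//].
  have : nbhs (x, y) ((fun xy : G * G => (xy.1 * xy.2)%g) @^-1` W).
    apply: (@mulg_continuous G (x, y)); exact: open_nbhs_nbhs.
  move=> [[U V] /= [Ux Vy] UVW].
  have [U' [BU U'x] U'U] := nB _ _ Ux; have [V' [BV V'y] V'V] := nB _ _ Vy.
  exists (U', V') => //; split=> // -[a b] /= [/U'U Ua /V'V Vb].
  exact: (UVW (a, b)).
apply: countable_bigcup_measurable => // -[U V] [/= BU BV _].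
by apply: measurableX; apply: sub_sigma_algebra; exact: Bo.
Qed.

(** [P] is the law of the product of independent variables of laws [mu] and [nu]; the formula for
    [Phir P] is a change of variables followed by Fubini. *)
Lemma Phi_convolution mu nu : exists P : probability (borel G) R,
  convolution mu nu = P :> (set (borel G) -> \bar R) /\
  forall f, rucbr f -> Phir P f = Phir mu (Phir nu f).
Proof.
pose X : {mfun _ >-> _} := mfun_Sub (mem_set measurable_mulg).
exists (distribution (mu \x nu)%E X); split=> // f rf.
apply/funext => g; rewrite /Phir /Rintegral; congr fine.
have rgf : rucbr (fun x => f (g * x)%g) by exact: rucbr_ltrans.
have mgf : measurable_fun [set: borel G] (EFin \o (fun x => f (g * x)%g)).
  exact: (measurable_int _ (rucbr_integrable mu rgf)).
have igf : (mu \x nu)%E.-integrable [set: borel G * borel G]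
    ((EFin \o (fun x => f (g * x)%g)) \o X).
  apply: measurable_bounded_integrable => //.
  - by apply: le_lt_trans (ltry 1); exact: (@probability_le1 _ _ _ (mu \x nu)%E).
  - by apply: measurableT_comp (rucbr_measurable rgf) _; exact: measurable_mulg.
  - have [[M fM] _] := rf; exists M; split; first exact: num_real.
    by move=> N MN x _ /=; rewrite (le_trans (fM _)) ?ltW.
rewrite integral_distribution// -integral12_prod_meas1//.
apply: eq_integral => x _; rewrite /fubini_F /=.
rewrite fineK; last first.
  have := rucbr_integrable nu (rucbr_ltrans (g * x)%g rf).
  by move/(integrable_fin_num measurableT).
by apply: eq_integral => y _ /=; rewrite mulgA.
Qed.

(** Lets the convolution powers in the product of harmonic functions be replaced by iterates of one
    operator. *)
Lemma convolution_powerP mu n : exists P : probability (borel G) R,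
  convolution_power mu n = P :> (set (borel G) -> \bar R) /\
  forall f, rucbr f -> Phir P f = iter n (Phir mu) f.
Proof.
elim: n => [|n [P [PE PP]]].
  exists (\d_(1%g : borel G)); split=> // f rf; apply/funext => g.
  rewrite /Phir /Rintegral integral_dirac//.
    by rewrite diracT mul1e mulg1.
  exact: (measurable_int _ (rucbr_integrable mu (rucbr_ltrans g rf))).
have [Q [QE QQ]] := Phi_convolution mu P.
exists Q; split; first by rewrite -QE -PE.
by move=> f rf; rewrite QQ//= PP.
Qed.

End convolution_powers.

(** * Harmonic functions and boundary points *)

Section asymptotic_product.
Context (R : realType) (G : topologicalGroupType).
Variable mu : probability (borel G) R.
Implicit Types (f F q : G -> R) (g : G).

(** Convergence to 0 in mean along the random walk of law [mu] started at [g], as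
    [iter n (Phir mu) F g] is the expectation of [F] at time n. *)
Definition null_along f g :=
  iter n (Phir mu) (fun x => `|f x|) g @[n --> \oo] --> (0:R).

Lemma null_along_le f F g : rucbr f -> rucbr F ->
  (forall x, `|f x| <= F x) ->
  iter n (Phir mu) F g @[n --> \oo] --> (0:R) -> null_along f g.
Proof.
move=> rf rF fF F0; rewrite /null_along; apply: (squeeze_cvgr _ (cvg_cst 0) F0).
apply: nearW => n; apply/andP; split.
  have := @iter_Phir_cst _ _ mu 0 n; move=> /(congr1 (fun F => F g)) <-.
  by apply: le_iter_Phir => //; [exact: rucbr_cst|exact: rucbr_norm].
by apply: le_iter_Phir => //; exact: rucbr_norm.
Qed.

Lemma harmonic_iter f n : Phir mu f = f -> iter n (Phir mu) f = f.
Proof. by move=> hf; elim: n => //= n ->. Qed.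

(** Jensen's inequality, obtained by expanding the average at [g] of the nonnegative function (f - f
    g)^2. *)
Lemma sqr_le_Phir f g : rucbr f -> Phir mu f = f ->
  f g * f g <= Phir mu (fun x => f x * f x) g.
Proof.
move=> rf hf.
have rff : rucbr (fun x => f x * f x) by exact: rucbrM.
have : 0 <= Phir mu (fun x => f x * f x - (2 * f g) * f x + f g * f g) g.
  have := @Phir_cst _ _ mu 0; move=> /(congr1 (fun F => F g)) <-.
  apply: le_Phir => //; first exact: rucbr_cst.
    by apply: rucbrD (rucbr_cst _ _); apply: rucbrB => //; exact: rucbrZ.
  move=> x; have -> : f x * f x - 2 * f g * f x + f g * f g = (f x - f g) ^+ 2.
    by ring.
  exact: sqr_ge0.
rewrite PhirD ?Phir_cst ?PhirB ?PhirZ ?hf//.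
- lra.
- exact: rucbrZ.
- by apply: rucbrB => //; exact: rucbrZ.
- exact: rucbr_cst.
Qed.

(** The iterates of f^2 increase to some [s], which is harmonic by dominated convergence and lies
    above f^2. So the iterates of |f^2 - s| = s - f^2 are [s] minus those of f^2, and tend to 0. *)
Lemma harmonic_sqr f : rucbr f -> Phir mu f = f -> exists s,
  [/\ rucbr s,
      forall g, iter n (Phir mu) (fun x => f x * f x) g @[n --> \oo] --> s g &
      forall g, null_along (fun x => f x * f x - s x) g].
Proof.
move=> rf hf; pose f2 := fun x => f x * f x; pose u n := iter n (Phir mu) f2.
have rf2 : rucbr f2 by exact: rucbrM.
have nd g : nondecreasing_seq (fun n => u n g).
  apply/nondecreasing_seqP => n; rewrite /u iterSr; apply: le_iter_Phir => //.
    exact: rucbr_Phir.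
  by move=> x; exact: sqr_le_Phir.
have cu n : controls f2 (u n) by exact: iter_Phir_controls.
have cvu g : cvgn (fun n => u n g).
  apply: nondecreasing_is_cvgn => //; have [[M fM] _] := rf2.
  by exists M => _ [n _ <-]; rewrite (le_trans (ler_norm _))//; exact: (cu n).1.
pose s : G -> R := fun g => limn (fun n => u n g).
have us g : u n g @[n --> \oo] --> s g by exact: cvu.
have rs : rucbr s.
  by apply: controls_rucbr rf2; exact: controls_lim us.
have hs : Phir mu s = s.
  apply/funext => g; have := @Phir_cvg _ _ mu f2 u s rf2 cu us g.
  move=> /cvg_lim <- //; apply/cvg_lim => //.
  by rewrite (cvg_shiftS (fun n => u n g)).
exists s; split=> // g.
have f2s x : f2 x <= s x by exact: (nondecreasing_cvgn_le (nd x) (cvu x) 0%N).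
apply: (null_along_le (F := fun x => s x - f2 x)).
- exact: rucbrB.
- exact: rucbrB.
- by move=> x; rewrite -/(f2 x) distrC ger0_norm// subr_ge0.
have -> : (fun n => iter n (Phir mu) (fun x => s x - f2 x) g) =
    (fun n => s g - u n g).
  by apply/funext => n; rewrite iter_PhirB// harmonic_iter.
by rewrite -[X in _ --> X](subrr (s g)); apply: cvgB; [exact: cvg_cst|].
Qed.

(* Polarization reduces the product to squares, whose images under the       *)
(* iterates of Phir increase by Jensen's inequality.                         *)
Lemma harmonic_mul f1 f2 : rucbr f1 -> Phir mu f1 = f1 ->
  rucbr f2 -> Phir mu f2 = f2 -> exists q,
  [/\ rucbr q,
      forall g, iter n (Phir mu) (fun x => f1 x * f2 x) g @[n --> \oo] --> q g &
      forall g, null_along (fun x => f1 x * f2 x - q x) g].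
Proof.
move=> r1 h1 r2 h2.
have [s1 [rs1 c1 n1]] := harmonic_sqr r1 h1.
have [s2 [rs2 c2 n2]] := harmonic_sqr r2 h2.
have r12 : rucbr (fun x => f1 x + f2 x) by exact: rucbrD.
have h12 : Phir mu (fun x => f1 x + f2 x) = fun x => f1 x + f2 x.
  by rewrite PhirD// h1 h2.
have [s3 [rs3 c3 n3]] := harmonic_sqr r12 h12.
have R11 := rucbrM r1 r1; have R22 := rucbrM r2 r2; have R33 := rucbrM r12 r12.
exists (fun x => 2^-1 * (s3 x - (s1 x + s2 x))).
have rq : rucbr (fun x => 2^-1 * (s3 x - (s1 x + s2 x))).
  by apply: rucbrZ; apply: rucbrB => //; exact: rucbrD.
split=> // g.
  have -> : (fun x => f1 x * f2 x) = (fun x => 2^-1 *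
      ((f1 x + f2 x) * (f1 x + f2 x) - (f1 x * f1 x + f2 x * f2 x))).
    by apply/funext => x; field.
  have -> : (fun n => iter n (Phir mu) (fun x => 2^-1 *
      ((f1 x + f2 x) * (f1 x + f2 x) - (f1 x * f1 x + f2 x * f2 x))) g) =
    (fun n => 2^-1 * (iter n (Phir mu) (fun x => (f1 x + f2 x) * (f1 x + f2 x)) g
      - (iter n (Phir mu) (fun x => f1 x * f1 x) g +
         iter n (Phir mu) (fun x => f2 x * f2 x) g))).
    apply/funext => n; rewrite iter_PhirZ; last first.
      by apply: rucbrB => //; exact: rucbrD.
    by rewrite iter_PhirB//; [rewrite iter_PhirD|exact: rucbrD].
  by apply: cvgM; [exact: cvg_cst|]; apply: cvgB => //; exact: cvgD.
have RD1 := rucbr_norm (rucbrB R11 rs1).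
have RD2 := rucbr_norm (rucbrB R22 rs2).
have RD3 := rucbr_norm (rucbrB R33 rs3).
apply: (null_along_le (F := fun x =>
    `|(f1 x + f2 x) * (f1 x + f2 x) - s3 x| +
    (`|f1 x * f1 x - s1 x| + `|f2 x * f2 x - s2 x|))).
- by apply: rucbrB => //; exact: rucbrM.
- by apply: rucbrD => //; exact: rucbrD.
- move=> x; have -> : f1 x * f2 x - 2^-1 * (s3 x - (s1 x + s2 x)) =
    2^-1 * (((f1 x + f2 x) * (f1 x + f2 x) - s3 x) -
    ((f1 x * f1 x - s1 x) + (f2 x * f2 x - s2 x))) by field.
  rewrite normrM gtr0_norm ?invr_gt0//.
  apply: (@le_trans _ _ (1 * `|((f1 x + f2 x) * (f1 x + f2 x) - s3 x) -
    ((f1 x * f1 x - s1 x) + (f2 x * f2 x - s2 x))|)).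
    by apply: ler_wpM2r => //; rewrite invf_le1// ler1n.
  rewrite mul1r (le_trans (ler_normB _ _))// lerD2l; exact: ler_normD.
have -> : (fun n => iter n (Phir mu) (fun x =>
    `|(f1 x + f2 x) * (f1 x + f2 x) - s3 x| +
    (`|f1 x * f1 x - s1 x| + `|f2 x * f2 x - s2 x|)) g) =
  (fun n => iter n (Phir mu) (fun x => `|(f1 x + f2 x) * (f1 x + f2 x) - s3 x|) g +
    (iter n (Phir mu) (fun x => `|f1 x * f1 x - s1 x|) g +
     iter n (Phir mu) (fun x => `|f2 x * f2 x - s2 x|) g)).
  apply/funext => n; rewrite iter_PhirD//; last exact: rucbrD.
  by rewrite iter_PhirD.
rewrite -[X in _ --> X](addr0 0); apply: cvgD; first exact: n3.
by rewrite -[X in _ --> X](addr0 0); apply: cvgD; [exact: n1|exact: n2].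
Qed.

(* With u = (f - c)^+, V refines the sets {a < e} for a >= 0 such that        *)
(* Phi^n (a u) (g) tends to 0: they are nonempty as Phi^n u (g) >= f g - c,   *)
(* and a = (f - c)^- is allowed as then a u = 0.                              *)
Lemma boundary_ultrafilter f g c : rucbr f -> Phir mu f = f -> c < f g ->
  exists V : set_system G, [/\ UltraFilter V,
    forall a (e : R), rucbr a -> null_along a g -> 0 < e ->
      V [set x | `|a x| < e] &
    forall e : R, 0 < e -> V [set x | c - e < f x]].
Proof.
move=> rf hf cf.
pose u x := 2^-1 * (`|f x - c| + (f x - c)).
have rfc : rucbr (fun x => f x - c) by apply: rucbrB => //; exact: rucbr_cst.
have ru : rucbr u by apply: rucbrZ; apply: rucbrD => //; exact: rucbr_norm.
have u0 x : 0 <= u x.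
  by rewrite /u mulr_ge0 ?invr_ge0// -lerBlDr sub0r -normrN ler_norm.
pose null a := [/\ rucbr a, forall x, 0 <= a x &
  iter n (Phir mu) (fun x => a x * u x) g @[n --> \oo] --> (0:R)].
pose B := [set ae : (G -> R) * R | null ae.1 /\ 0 < ae.2].
pose S (ae : (G -> R) * R) := [set x | ae.1 x < ae.2].
have nullD a b : null a -> null b -> null (fun x => a x + b x).
  move=> [ra a0 na] [rb b0 nb]; split; first exact: rucbrD.
    by move=> x; rewrite addr_ge0.
  have -> : (fun n => iter n (Phir mu) (fun x => (a x + b x) * u x) g) =
      (fun n => iter n (Phir mu) (fun x => a x * u x) g +
                iter n (Phir mu) (fun x => b x * u x) g).
    apply/funext => n.
    rewrite (_ : (fun x => _) = fun x => a x * u x + b x * u x).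
      by rewrite iter_PhirD//; exact: rucbrM.
    by apply/funext => x; rewrite mulrDl.
  by rewrite -[X in _ --> X](addr0 0); exact: cvgD.
have FF : ProperFilter (filter_from B S).
  apply: filter_from_proper; last first.
    move=> [a e] [/= [ra a0 na] e0]; apply: contrapT => aS.
    (* If a >= e everywhere, the iterates of a u at [g] stay above those of e (f - c), which all
       equal e (f g - c) > 0. *)
    have ae x : e <= a x.
      by rewrite leNgt; apply/negP => axe; apply: aS; exists x.
    suff : e * (f g - c) <= 0.
      by rewrite leNgt mulr_gt0// subr_gt0.
    apply: (cvgr_to_ge na); apply: nearW => n.
    have <- : iter n (Phir mu) (fun x => e * (f x - c)) g = e * (f g - c).
      rewrite iter_PhirZ// iter_PhirB// ?iter_Phir_cst ?harmonic_iter//.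
      exact: rucbr_cst.
    apply: le_iter_Phir; [exact: rucbrZ|exact: rucbrM|] => x.
    apply: (@le_trans _ _ (e * u x)); last exact: ler_wpM2r.
    rewrite ler_pM2l// /u; have := ler_norm (f x - c); lra.
  apply: filter_from_filter.
    exists (fun=> 0, 1); split=> //; split=> //; first exact: rucbr_cst.
    rewrite (_ : (fun n => _) = fun=> 0); first exact: cvg_cst.
    apply/funext => n; rewrite (_ : (fun x => _) = fun=> 0) ?iter_Phir_cst//.
    by apply/funext => x; rewrite mul0r.
  move=> [a d] [b e] [/= na d0] [/= nb e0].
  exists (fun x => a x + b x, Num.min d e).
    by split; [exact: nullD|rewrite /= lt_min d0 e0].
  move=> x; rewrite /S /= lt_min => /andP[abd abe]; have [_ a0 _] := na.
  have [_ b0 _] := nb; split=> /=.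
    by rewrite (le_lt_trans _ abd)// lerDl.
  by rewrite (le_lt_trans _ abe)// lerDr.
have [V [UV FV]] := ultraFilterLemma FF; exists V; split=> // [a e ra na e0|e e0].
  apply: FV; exists (fun x => `|a x|, e) => //; split=> //; split.
  - exact: rucbr_norm.
  - by move=> x; exact: normr_ge0.
  have [[M uM] _] := ru.
  have M0 : 0 <= M by rewrite (le_trans _ (uM 1%g)).
  have rau : rucbr (fun x => `|a x| * u x).
    by apply: rucbrM => //; exact: rucbr_norm.
  have Ma0 : iter n (Phir mu) (fun x => M * `|a x|) g @[n --> \oo] --> (0:R).
    have -> : (fun n => iter n (Phir mu) (fun x => M * `|a x|) g) =
        (fun n => M * iter n (Phir mu) (fun x => `|a x|) g).
      by apply/funext => n; rewrite iter_PhirZ//; exact: rucbr_norm.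
    by rewrite -[X in _ --> X](mulr0 M); apply: cvgM => //; exact: cvg_cst.
  have : null_along (fun x => `|a x| * u x) g.
    apply: null_along_le Ma0 => //; first by apply: rucbrZ; exact: rucbr_norm.
    by move=> x; rewrite normrM normr_id mulrC ler_wpM2r//; exact: uM.
  have E : (fun x => `| `|a x| * u x|) = (fun x => `|a x| * u x).
    by apply/funext => x; rewrite ger0_norm// mulr_ge0.
  by rewrite /null_along E.
apply: FV; exists (fun x => 2^-1 * (`|f x - c| - (f x - c)), e).
  split=> //; split.
  - by apply: rucbrZ; apply: rucbrB => //; exact: rucbr_norm.
  - by move=> x; rewrite mulr_ge0 ?invr_ge0// subr_ge0 ler_norm.
  - rewrite (_ : (fun n => _) = fun=> 0); first exact: cvg_cst.
    apply/funext => n; rewrite (_ : (fun x => _) = fun=> 0) ?iter_Phir_cst//.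
    apply/funext => x; rewrite /u.
    have -> : 2^-1 * (`|f x - c| - (f x - c)) * (2^-1 * (`|f x - c| + (f x - c)))
      = 2^-1 * 2^-1 * (`|f x - c| ^+ 2 - (f x - c) ^+ 2) by ring.
    by rewrite real_normK ?num_real// subrr mulr0.
move=> x; rewrite /S /=; have := ler_norm (c - f x); rewrite distrC; lra.
Qed.

End asymptotic_product.

(** * Limits along ultrafilters, and the boundary points they define *)

Section ultralimits.
Context (R : realType) (T : Type) (V : set_system T).
Hypothesis UV : UltraFilter V.
Implicit Types f : T -> R.

(** The image ultrafilter contains a segment, which is compact. *)
Lemma ultrafilter_cvg f (M : R) : (forall x, `|f x| <= M) -> cvg (f @ V).
Proof.
move=> fM; have UfV : UltraFilter (f @ V).
  split=> [|H HF fVH]; first exact: fmap_proper_filter.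
  apply/seteqP; split; last exact: fVH.
  move=> A HA; have [//|VA] := in_ultra_setVsetC (f @^-1` A) UV.
  have : H (A `&` ~` A) by apply: filterI => //; exact: fVH.
  by rewrite setICr => /filter_ex[].
have := @segment_compact R (- M) M; rewrite compact_ultra => /(_ _ UfV).
have fVM : (f @ V) [set` `[- M, M]].
  by apply: (@filterE _ V) => x; rewrite /= in_itv /= -ler_norml.
by move=> /(_ fVM)[l [_ fl]]; apply/cvg_ex; exists l.
Qed.

End ultralimits.

Section complex_rucb.
Context (R : realType) (G : topologicalGroupType).
Implicit Types (f : G -> R).

Lemma norm_Re_le (z : R[i]) (M : R) : `|z| <= M%:C -> `|complex.Re z| <= M.
Proof. by move=> zM; rewrite -lecR; exact: le_trans (normc_ge_Re _) zM. Qed.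

Lemma norm_Im_le (z : R[i]) (M : R) : `|z| <= M%:C -> `|complex.Im z| <= M.
Proof. by move=> zM; rewrite -lecR; exact: le_trans (normc_ge_Im _) zM. Qed.

Lemma rucbr_Re (F : RUCB R G) : rucbr (fun x => complex.Re (F x)).
Proof.
have /rucbP[[M FM] uF] := valP F.
split; first by exists M => x; exact/norm_Re_le/FM.
move=> e /uF[U U1 UF]; exists U => // x y /UF /norm_Re_le.
by rewrite raddfB.
Qed.

Lemma rucbr_Im (F : RUCB R G) : rucbr (fun x => complex.Im (F x)).
Proof.
have /rucbP[[M FM] uF] := valP F.
split; first by exists M => x; exact/norm_Im_le/FM.
move=> e /uF[U U1 UF]; exists U => // x y /UF /norm_Im_le.
by rewrite raddfB.
Qed.

Lemma norm_real_complex (a : R) : `|a%:C| = `|a|%:C.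
Proof. by rewrite normc_def /= expr0n addr0 sqrtr_sqr. Qed.

Lemma rucbr_rucb f : rucbr f ->
  ((fun x => (f x)%:C) : G -> Cplx R) \in @rucb R G.
Proof.
move=> [[M fM] uf]; apply/rucbP; split.
  by exists M => x; rewrite norm_real_complex lecR.
move=> e /uf[U U1 Uf]; exists U => // x y /Uf fxy.
by rewrite -rmorphB norm_real_complex lecR.
Qed.

Definition RUCB_of_real f (rf : rucbr f) : RUCB R G := MkRUCB (rucbr_rucb rf).

Lemma Phi_prob (mu : probability (borel G) R) (F : G -> Cplx R) g :
  Phi mu F g = Phir mu (fun x => complex.Re (F x)) g +i*
               Phir mu (fun x => complex.Im (F x)) g.
Proof. by []. Qed.

Lemma cvg_Re (u : nat -> Cplx R) (l : Cplx R) : u n @[n --> \oo] --> l ->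
  complex.Re (u n) @[n --> \oo] --> complex.Re l.
Proof.
move=> /cvgrPdist_le ul; apply/cvgrPdist_le => e e0.
have := ul e%:C; rewrite ltcR => /(_ e0); apply: filterS => n.
by move/norm_Re_le; rewrite raddfB.
Qed.

Lemma cvg_Im (u : nat -> Cplx R) (l : Cplx R) : u n @[n --> \oo] --> l ->
  complex.Im (u n) @[n --> \oo] --> complex.Im l.
Proof.
move=> /cvgrPdist_le ul; apply/cvgrPdist_le => e e0.
have := ul e%:C; rewrite ltcR => /(_ e0); apply: filterS => n.
by move/norm_Im_le; rewrite raddfB.
Qed.

End complex_rucb.

Section boundary.
Context (R : realType) (G : topologicalGroupType).
Hypothesis countableG : @second_countable G.
Variable mu : probability (borel G) R.
Implicit Types (f : G -> R) (F : harmonic_fun mu).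

Lemma harmonic_Re F : Phir mu (fun x => complex.Re (F x)) =
  fun x => complex.Re (F x).
Proof.
apply/funext => g.
by have /is_harmonicP/(congr1 (fun H => complex.Re (H g))) := valP F.
Qed.

Lemma harmonic_Im F : Phir mu (fun x => complex.Im (F x)) =
  fun x => complex.Im (F x).
Proof.
apply/funext => g.
by have /is_harmonicP/(congr1 (fun H => complex.Im (H g))) := valP F.
Qed.

Lemma harmonic_of_real_subproof f (rf : rucbr f) : Phir mu f = f ->
  RUCB_of_real rf \in is_harmonic mu.
Proof.
move=> hf; apply/is_harmonicP/funext => g; rewrite Phi_prob /=.
by rewrite Phir_cst hf.
Qed.

Definition harmonic_of_real f (rf : rucbr f) (hf : Phir mu f = f) :=
  MkHarmonic (harmonic_of_real_subproof rf hf).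

Definition boundary_point (V : set_system G) F : Cplx R :=
  lim ((fun x => complex.Re (F x)) @ V) +i*
  lim ((fun x => complex.Im (F x)) @ V).

Lemma is_harmonic_mulE F1 F2 H g : is_harmonic_mul F1 F2 H ->
  iter n (Phir mu) (fun x => complex.Re (F1 x * F2 x)) g @[n --> \oo] -->
    complex.Re (H g) /\
  iter n (Phir mu) (fun x => complex.Im (F1 x * F2 x)) g @[n --> \oo] -->
    complex.Im (H g).
Proof.
move=> /(_ g) FH.
have rM : rucbr (fun x => complex.Re (F1 x * F2 x)).
  rewrite (_ : (fun x => _) = fun x => complex.Re (F1 x) * complex.Re (F2 x) -
     complex.Im (F1 x) * complex.Im (F2 x)).
    by apply: rucbrB; apply: rucbrM; (exact: rucbr_Re || exact: rucbr_Im).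
  by apply/funext => x; case: (F1 x) (F2 x) => ? ? [].
have iM : rucbr (fun x => complex.Im (F1 x * F2 x)).
  rewrite (_ : (fun x => _) = fun x => complex.Re (F1 x) * complex.Im (F2 x) +
     complex.Im (F1 x) * complex.Re (F2 x)).
    by apply: rucbrD; apply: rucbrM; (exact: rucbr_Re || exact: rucbr_Im).
  by apply/funext => x; case: (F1 x) (F2 x) => ? ? [].
have E n : Phi (convolution_power mu n) (fun x => F1 x * F2 x) g =
    iter n (Phir mu) (fun x => complex.Re (F1 x * F2 x)) g +i*
    iter n (Phir mu) (fun x => complex.Im (F1 x * F2 x)) g.
  have [P [-> PP]] := convolution_powerP countableG mu n.
  by rewrite Phi_prob !PP.
move: FH; rewrite (funext E) => FH.
by split; [exact: (cvg_Re FH)|exact: (cvg_Im FH)].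
Qed.

Section boundary_point.
Variables (f : G -> R) (g : G) (c : R).
Hypotheses (rf : rucbr f) (hf : Phir mu f = f).
Variable V : set_system G.
Hypothesis UV : UltraFilter V.
Hypothesis VN : forall a (e : R), rucbr a -> null_along mu a g -> 0 < e ->
  V [set x | `|a x| < e].

Let cvgV (a : G -> R) : rucbr a -> cvg (a @ V).
Proof. by move=> [[M aM] _]; exact: ultrafilter_cvg aM. Qed.

(** The difference between the pointwise product and the harmonic product [q] is null along the walk
    from [g], so it tends to 0 along [V] by [VN]. *)
Let limVM (a b : G -> R) : rucbr a -> Phir mu a = a -> rucbr b -> Phir mu b = b ->
  exists q, [/\ rucbr q,
    forall x, iter n (Phir mu) (fun x => a x * b x) x @[n --> \oo] --> q x &
    lim (q @ V) = lim (a @ V) * lim (b @ V)].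
Proof.
move=> ra ha rb hb; have [q [rq cq nq]] := harmonic_mul ra ha rb hb.
exists q; split=> //; apply/cvg_lim => //.
have ab0 : a x * b x - q x @[x --> V] --> (0:R).
  apply/cvgr0Pnorm_lt => e e0; apply: VN => //; apply: rucbrB => //.
  exact: rucbrM.
have -> : q = fun x => a x * b x - (a x * b x - q x).
  by apply/funext => x; rewrite subKr.
rewrite -[X in _ --> X]subr0; apply: cvgB => //.
by apply: cvgM; exact: cvgV.
Qed.

Let limE (a : G -> R) (l : R) : a x @[x --> V] --> l -> lim (a @ V) = l.
Proof. by move=> al; exact/cvg_lim. Qed.

Lemma boundary_pointP : poisson_boundary (boundary_point V).
Proof.
have cRe F : cvg ((fun x => complex.Re (F x)) @ V) by exact/cvgV/rucbr_Re.
have cIm F : cvg ((fun x => complex.Im (F x)) @ V) by exact/cvgV/rucbr_Im.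
split.
- move=> [a b] F1 F2; apply/eqP; rewrite eq_complex; apply/andP; split; apply/eqP.
    have -> : complex.Re (boundary_point V ((a +i* b) *: F1 + F2)) =
        lim ((fun x => a * complex.Re (F1 x) - b * complex.Im (F1 x)
          + complex.Re (F2 x)) @ V).
      congr (lim (_ @ V)); apply/funext => x.
      rewrite [(_ *: F1 + F2) x](_ : _ = (a +i* b) * F1 x + F2 x)//.
      by case: (F1 x) (F2 x) => ? ? [].
    exact: (limE (cvgD (cvgB (cvgM (cvg_cst _) (cRe F1))
      (cvgM (cvg_cst _) (cIm F1))) (cRe F2))).
  have -> : complex.Im (boundary_point V ((a +i* b) *: F1 + F2)) =
      lim ((fun x => a * complex.Im (F1 x) + b * complex.Re (F1 x)
        + complex.Im (F2 x)) @ V).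
    congr (lim (_ @ V)); apply/funext => x.
    rewrite [(_ *: F1 + F2) x](_ : _ = (a +i* b) * F1 x + F2 x)//.
    by case: (F1 x) (F2 x) => ? ? [].
  exact: (limE (cvgD (cvgD (cvgM (cvg_cst _) (cIm F1))
    (cvgM (cvg_cst _) (cRe F1))) (cIm F2))).
- rewrite /boundary_point (_ : lim _ = 1 :> R); last first.
    exact: (@limE (fun=> 1) 1 (cvg_cst _)).
  by rewrite (_ : lim _ = 0 :> R)//; exact: (@limE (fun=> 0) 0 (cvg_cst _)).
- move=> F; rewrite /boundary_point /=.
  have -> : (fun x => complex.Re (F x)^*) = fun x => complex.Re (F x).
    by apply/funext => x; case: (F x).
  have -> : (fun x => complex.Im (F x)^*) = fun x => - complex.Im (F x).
    by apply/funext => x; case: (F x).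
  congr (_ +i* _); apply/cvg_lim => //; exact: cvgN.
(* Real and imaginary parts reduce multiplicativity to four real products; uniqueness of limits
   expresses [H] through them. *)
- move=> F1 F2 H F12.
  have [r1 i1] := (rucbr_Re F1, rucbr_Im F1).
  have [hr1 hi1] := (harmonic_Re F1, harmonic_Im F1).
  have [r2 i2] := (rucbr_Re F2, rucbr_Im F2).
  have [hr2 hi2] := (harmonic_Re F2, harmonic_Im F2).
  have [qrr [rqrr crr lrr]] := limVM r1 hr1 r2 hr2.
  have [qii [rqii cii lii]] := limVM i1 hi1 i2 hi2.
  have [qri [rqri cri lri]] := limVM r1 hr1 i2 hi2.
  have [qir [rqir cir lir]] := limVM i1 hi1 r2 hr2.
  have ReH : (fun x => complex.Re (H x)) = fun x => qrr x - qii x.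
    apply/funext => x; have [+ _] := is_harmonic_mulE x F12.
    move=> /cvg_lim <- //; apply/cvg_lim => //.
    rewrite (_ : (fun n => _) = fun n =>
      iter n (Phir mu) (fun x => complex.Re (F1 x) * complex.Re (F2 x)) x -
      iter n (Phir mu) (fun x => complex.Im (F1 x) * complex.Im (F2 x)) x).
      by apply: cvgB; [exact: crr|exact: cii].
    apply/funext => n; transitivity (iter n (Phir mu) (fun x =>
      complex.Re (F1 x) * complex.Re (F2 x) -
      complex.Im (F1 x) * complex.Im (F2 x)) x);
      last by rewrite iter_PhirB//; exact: rucbrM.
    congr (iter n _ _ x); apply/funext => y.
    by case: (F1 y) (F2 y) => ? ? [].
  have ImH : (fun x => complex.Im (H x)) = fun x => qri x + qir x.
    apply/funext => x; have [_ +] := is_harmonic_mulE x F12.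
    move=> /cvg_lim <- //; apply/cvg_lim => //.
    rewrite (_ : (fun n => _) = fun n =>
      iter n (Phir mu) (fun x => complex.Re (F1 x) * complex.Im (F2 x)) x +
      iter n (Phir mu) (fun x => complex.Im (F1 x) * complex.Re (F2 x)) x).
      by apply: cvgD; [exact: cri|exact: cir].
    apply/funext => n; transitivity (iter n (Phir mu) (fun x =>
      complex.Re (F1 x) * complex.Im (F2 x) +
      complex.Im (F1 x) * complex.Re (F2 x)) x);
      last by rewrite iter_PhirD//; exact: rucbrM.
    congr (iter n _ _ x); apply/funext => y.
    by case: (F1 y) (F2 y) => ? ? [].
  rewrite /boundary_point ReH ImH (limE (cvgB (cvgV rqrr) (cvgV rqii))).
  by rewrite (limE (cvgD (cvgV rqri) (cvgV rqir))) lrr lii lri lir.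
Qed.

Lemma boundary_point_ge : (forall e : R, 0 < e -> V [set x | c - e < f x]) ->
  c <= complex.Re (boundary_point V (harmonic_of_real rf hf)).
Proof.
move=> Vc; rewrite /boundary_point /=; apply/ler_addgt0Pr => e e0.
rewrite -lerBlDr; apply: limr_ge; first exact: cvgV.
by apply: filterS (Vc _ e0) => x /ltW.
Qed.

End boundary_point.

(** For c just below a value of [f] there is a boundary point at which [f] is at least c, and that
    point must be [chi]. Hence [chi] of [f] bounds all values of [f]; the same for -f leaves only
    one value. *)
Lemma trivial_boundary_harmonic : trivial_poisson_boundary mu ->
  forall f, rucbr f -> Phir mu f = f -> forall g h, f g = f h.
Proof.
move=> [chi chiE] f rf hf.
have chi_ge f' (rf' : rucbr f') (hf' : Phir mu f' = f') g :
    f' g <= complex.Re (chi (harmonic_of_real rf' hf')).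
  apply/ler_addgt0Pr => e e0; rewrite -lerBlDr.
  have [|V [UV VN Vc]] := @boundary_ultrafilter _ _ _ f' g (f' g - e) rf' hf'.
    by rewrite gtrBl.
  have := boundary_pointP UV VN; rewrite chiE => <-.
  exact: boundary_point_ge.
have rN := rucbrN rf.
have hN : Phir mu (fun x => - f x) = fun x => - f x.
  have -> : (fun x => - f x) = fun x => -1 * f x.
    by apply/funext => x; rewrite mulN1r.
  by rewrite PhirZ// hf.
have chiN : chi (harmonic_of_real rN hN) = - chi (harmonic_of_real rf hf).
  have [+ _ _ _] : poisson_boundary chi by rewrite chiE.
  move=> lchi; have chi0 : chi 0 = 0.
    by have := lchi (-1) 0 0; rewrite scaler0 addr0 mulN1r addNr.
  transitivity (chi (-1 *: harmonic_of_real rf hf + 0)); last first.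
    by rewrite lchi chi0 mulN1r addr0.
  congr chi; apply: val_inj; apply: val_inj.
  apply/funext => x; apply/eqP; rewrite eq_complex.
  by apply/andP; split; apply/eqP => /=; ring.
suff le g h : f g <= f h by move=> g h; apply/eqP; rewrite eq_le !le.
apply: (le_trans (chi_ge f rf hf g)).
have := chi_ge _ rN hN h; rewrite chiN raddfN /= lerN2; exact.
Qed.

(** On constants, linearity and the value at the unit determine a character, which is evaluation at
    1. *)
Lemma harmonic_cst_trivial_boundary :
  (forall f, rucbr f -> Phir mu f = f -> forall g h, f g = f h) ->
  trivial_poisson_boundary mu.
Proof.
move=> cst.
have Fcst F x : F x = F 1%g.
  have := cst _ (rucbr_Re F) (harmonic_Re F) x 1%g.
  have := cst _ (rucbr_Im F) (harmonic_Im F) x 1%g.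
  by case: (F x) (F 1%g) => ? ? [? ?] /= -> ->.
exists (fun F => F 1%g); apply/seteqP; split=> chi.
  move=> [lchi chi1 _ _]; apply/funext => F.
  have chi0 : chi 0 = 0.
    by have := lchi (-1) 0 0; rewrite scaler0 addr0 mulN1r addNr.
  transitivity (chi (F 1%g *: harmonic_one mu + 0)); last first.
    by rewrite lchi chi0 chi1 mulr1 addr0.
  congr chi; apply: val_inj; apply: val_inj; apply/funext => x /=.
  by rewrite [RHS]addr0 [RHS]mulr1.
move=> ->; split=> //.
move=> F1 F2 H /is_harmonic_mulE => /(_ 1%g)[].
have -> : (fun x => complex.Re (F1 x * F2 x)) = fun=> complex.Re (F1 1%g * F2 1%g).
  by apply/funext => x; rewrite (Fcst F1) (Fcst F2).
have -> : (fun x => complex.Im (F1 x * F2 x)) = fun=> complex.Im (F1 1%g * F2 1%g).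
  by apply/funext => x; rewrite (Fcst F1) (Fcst F2).
under eq_fun do rewrite iter_Phir_cst.
move=> HRe; under eq_fun do rewrite iter_Phir_cst.
move=> HIm; apply/eqP; rewrite eq_complex; apply/andP; split; apply/eqP.
  by move/cvg_lim : HRe => <- //; apply/cvg_lim => //; exact: cvg_cst.
by move/cvg_lim : HIm => <- //; apply/cvg_lim => //; exact: cvg_cst.
Qed.

End boundary.

(** * Invariant means from the Liouville property *)

Section amenability_of_liouville.
Context (R : realType) (G : topologicalGroupType).
Hypothesis countableG : @second_countable G.

Lemma dense_sequence : exists d : nat -> G,
  forall O : set G, open O -> O !=set0 -> exists i, O (d i).
Proof.
have [B cB [Bo nB]] := countableG.
move/pfcard_geP : cB => [B0|[h]].
  have [|b []] := nB (1%g : G) setT; first exact: filterT.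
  by rewrite B0.
(* One point from each basic set; 1 is a dummy for the empty one. *)
exists (fun i => xget 1%g (h i)) => W oW [x Wx].
have [|b [Bb bx] bW] := nB x W; first exact: open_nbhs_nbhs.
have [i _ hi] := (@surj _ _ _ _ h) b Bb.
exists i; apply: bW; rewrite hi; exact: (xgetI _ bx).
Qed.

(** By equicontinuity, approximating the ultralimit ever better at ever more points of a dense
    sequence already forces convergence at every point. *)
Lemma ultralimit_subsequence (U : set_system nat) (f F : G -> R)
    (u : nat -> G -> R) : ProperFilter U -> (forall j, U [set n | (j <= n)%N]) ->
  rucbr f -> (forall n, controls f (u n)) ->
  (forall x, u n x @[n --> U] --> F x) ->
  exists phi : nat -> nat, (forall j, (j <= phi j)%N) /\
    forall x, u (phi j) x @[j --> \oo] --> F x.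
Proof.
move=> PU Uoo rf cu uF; have [d dd] := dense_sequence.
have cF : controls f F by exact: controls_lim uF.
have near_d j i : U [set n | `|F (d i) - u n (d i)| < j.+1%:R^-1].
  by have /cvgrPdist_lt := uF (d i); apply; rewrite invr_gt0.
have near_ds j k : U [set n | forall i, (i < k)%N ->
    `|F (d i) - u n (d i)| < j.+1%:R^-1].
  elim: k => [|k IH]; first by apply: filterS filterT => n _ i.
  apply: filterS (filterI IH (near_d j k)) => n [/= nk nn] i.
  by rewrite ltnS leq_eqVlt => /orP[/eqP->|/nk].
(* The index chosen for j is at least j and accurate to 1/(j+1) at the first j+1 dense points. *)
have ex j : exists n, (j <= n)%N /\ forall i, (i <= j)%N ->
    `|F (d i) - u n (d i)| < j.+1%:R^-1.
  by have [n [? ?]] := filter_ex (filterI (Uoo j) (near_ds j j.+1)); exists n.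
have [phi phiP] := choice ex; exists phi; split=> [j|x]; first by have [] := phiP j.
apply/cvgrPdist_le => e e0; have e3 : 0 < e / 3 by rewrite divr_gt0.
have [V V1 Vf] := rf.2 _ e3.
have [i Vi] : exists i, V (d i * x^-1)%g.
  have : nbhs x [set y | V (y * x^-1)%g] by apply: mulgr_continuous; rewrite mulgV.
  rewrite nbhsE => -[W [oW Wx] WV]; have [|i Wi] := dd W oW; first by exists x.
  by exists i; exact: WV.
near=> j.
have ij : (i <= j)%N by near: j; exact: nbhs_infty_ge.
have j3 : j.+1%:R^-1 <= e / 3.
  near: j; apply: filterS (near_infty_natSinv_lt (PosNum e3)) => n.
  exact: ltW.
have [_ /(_ i ij) Fi] := phiP j.
have F1 := cF.2 _ _ Vf _ _ Vi; have u1 := (cu (phi j)).2 _ _ Vf _ _ Vi.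
have -> : F x - u (phi j) x = - (F (d i) - F x) + (F (d i) - u (phi j) (d i)) +
  (u (phi j) (d i) - u (phi j) x) by ring.
have -> : e = e / 3 + e / 3 + e / 3 by field.
rewrite (le_trans (ler_normD _ _))// lerD//.
by rewrite (le_trans (ler_normD _ _))// normrN lerD// ltW// (lt_le_trans Fi).
Unshelve. all: by end_near. Qed.

Section cesaro.
Variable mu : probability (borel G) R.
Implicit Types f : G -> R.

Definition cesaro n f : G -> R :=
  fun g => n.+1%:R^-1 * \sum_(k < n.+1) iter k (Phir mu) f g.

Lemma cesaro_controls n f : rucbr f -> controls f (cesaro n f).
Proof.
move=> rf; split=> [M fM g|V e fV x y Vxy].
  rewrite /cesaro normrM gtr0_norm ?invr_gt0//.
  rewrite mulrC ler_pdivrMr// (le_trans (ler_norm_sum _ _ _))//.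
  apply: (@le_trans _ _ (\sum_(k < n.+1) M)).
    by apply: ler_sum => k _; exact: (iter_Phir_controls mu k rf).1.
  by rewrite sumr_const card_ord mulr_natr.
rewrite /cesaro -mulrBr -sumrB normrM gtr0_norm ?invr_gt0//.
rewrite mulrC ler_pdivrMr// (le_trans (ler_norm_sum _ _ _))//.
apply: (@le_trans _ _ (\sum_(k < n.+1) e)).
  by apply: ler_sum => k _; exact: (iter_Phir_controls mu k rf).2 fV _ _ Vxy.
by rewrite sumr_const card_ord mulr_natr.
Qed.

Lemma cesaroD n f1 f2 g : rucbr f1 -> rucbr f2 ->
  cesaro n (fun x => f1 x + f2 x) g = cesaro n f1 g + cesaro n f2 g.
Proof.
move=> r1 r2; rewrite /cesaro -mulrDr -big_split /=; congr (_ * _).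
by apply: eq_bigr => k _; rewrite iter_PhirD.
Qed.

Lemma cesaroZ n a f g : rucbr f ->
  cesaro n (fun x => a * f x) g = a * cesaro n f g.
Proof.
move=> rf; rewrite /cesaro mulrCA; congr (_ * _).
by rewrite mulr_sumr; apply: eq_bigr => k _; rewrite iter_PhirZ.
Qed.

Lemma cesaro_cst n c : cesaro n (fun=> c) = fun=> c.
Proof.
apply/funext => g; rewrite /cesaro.
under eq_bigr do rewrite iter_Phir_cst.
by rewrite sumr_const card_ord -[c *+ _]mulr_natr mulrC mulfK// pnatr_eq0.
Qed.

Lemma cesaro_ge0 n f g : rucbr f -> (forall x, 0 <= f x) -> 0 <= cesaro n f g.
Proof.
move=> rf f0; apply: mulr_ge0; first by rewrite invr_ge0.
apply: sumr_ge0 => k _.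
have := @iter_Phir_cst _ _ mu 0 k; move=> /(congr1 (fun F => F g)) <-.
by apply: le_iter_Phir => //; exact: rucbr_cst.
Qed.

(** [Phir] averages right translates, which commute with left translations. *)
Lemma iter_Phir_ltrans n f g x :
  iter n (Phir mu) (fun y => f (g * y)%g) x = iter n (Phir mu) f (g * x)%g.
Proof.
elim: n x => //= n IH x; rewrite /Phir; congr (fine _).
by apply: eq_integral => y _; rewrite IH mulgA.
Qed.

Lemma cesaro_ltrans n f g :
  cesaro n (fun y => f (g * y)%g) 1%g = cesaro n f g.
Proof.
rewrite /cesaro; congr (_ * _); apply: eq_bigr => k _.
by rewrite iter_Phir_ltrans mulg1.
Qed.

(** Applying [Phir] shifts the sum by one index, so only the end terms differ. *)
Lemma Phir_cesaro n f g : rucbr f -> Phir mu (cesaro n f) g =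
  cesaro n f g + n.+1%:R^-1 * (iter n.+1 (Phir mu) f g - f g).
Proof.
move=> rf.
have sumP m : rucbr (fun x => \sum_(k < m) iter k (Phir mu) f x) /\
    Phir mu (fun x => \sum_(k < m) iter k (Phir mu) f x) g =
    \sum_(k < m) iter k.+1 (Phir mu) f g.
  elim: m => [|m [rm IH]].
    rewrite (_ : (fun x => _) = fun=> 0); last first.
      by apply/funext => x; rewrite big_ord0.
    by rewrite big_ord0 Phir_cst; split=> //; exact: rucbr_cst.
  rewrite (_ : (fun x => _) = fun x => \sum_(k < m) iter k (Phir mu) f x +
      iter m (Phir mu) f x); last by apply/funext => x; rewrite big_ord_recr.
  have ri := rucbr_iter mu m rf.
  by rewrite PhirD// IH big_ord_recr; split=> //; exact: rucbrD.
rewrite /cesaro PhirZ; last exact: (sumP _).1.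
rewrite (sumP _).2 -mulrDr; congr (_ * _).
rewrite [RHS]addrC big_ord_recr [in RHS]big_ord_recl /=; ring.
Qed.

(** Along a subsequence with [phi j] at least j, the defect in [Phir_cesaro] is at most 2M/(j+1),
    while dominated convergence passes [Phir] to the limit. *)
Lemma cesaro_ultralimit_harmonic (U : set_system nat) f F : ProperFilter U ->
  (forall j, U [set n | (j <= n)%N]) -> rucbr f ->
  (forall x, cesaro n f x @[n --> U] --> F x) -> Phir mu F = F.
Proof.
move=> PU Uoo rf fF.
have cn n := cesaro_controls n rf.
have [phi [phij phiF]] := ultralimit_subsequence PU Uoo rf cn fF.
apply/funext => g.
have := @Phir_cvg _ _ mu f (fun j => cesaro (phi j) f) F rf (fun j => cn _) phiF g.
move=> /cvg_lim <- //; apply/cvg_lim => //.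
rewrite (_ : (fun n => _) = fun j => cesaro (phi j) f g +
  (phi j).+1%:R^-1 * (iter (phi j).+1 (Phir mu) f g - f g)); last first.
  by apply/funext => j; rewrite Phir_cesaro.
rewrite -[X in _ --> X]addr0; apply: cvgD; first exact: phiF.
have [[M fM] _] := rf.
have M0 : 0 <= M by rewrite (le_trans _ (fM 1%g)).
apply: norm_cvg0; apply: (@squeeze_cvgr _ _ _ _ (fun=> 0)
  (fun j => (M + M) * j.+1%:R^-1)).
- apply: nearW => j; rewrite normr_ge0 /= normrM [leRHS]mulrC.
  apply: ler_pM => //.
    by rewrite gtr0_norm ?invr_gt0// lef_pV2 ?posrE// ler_nat ltnS.
  rewrite (le_trans (ler_normB _ _))// lerD//.
  exact: (iter_Phir_controls mu (phi j).+1 rf).1.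
- exact: cvg_cst.
- rewrite -[X in _ --> X](mulr0 (M + M)); apply: cvgM; first exact: cvg_cst.
  exact: cvg_harmonic.
Qed.

(** The mean of [f] is the constant value of the ultralimit [L f]. It is invariant because [L] of
    the translate of [f] by g takes at 1 the value [L f g], which is [L f 1]. *)
Lemma liouville_amenable :
  (forall f, rucbr f -> Phir mu f = f -> forall g h, f g = f h) ->
  amenable R G.
Proof.
move=> cst.
have [U [UU ooU]] := ultraFilterLemma (eventually_filter : ProperFilter \oo).
have Uoo j : U [set n | (j <= n)%N] by apply: ooU; exists j.
have cvgU f x : rucbr f -> cvg ((fun n => cesaro n f x) @ U).
  by move=> rf; have [[M fM] _] := rf; apply: (ultrafilter_cvg UU (M := M)) => n;
    exact: (cesaro_controls n rf).1.
pose L f g : R := lim ((fun n => cesaro n f g) @ U).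
have Lcvg f g : rucbr f -> cesaro n f g @[n --> U] --> L f g by exact: cvgU.
have LE f g l : cesaro n f g @[n --> U] --> l -> L f g = l.
  by move=> fl; exact/cvg_lim.
have Linv f g h : rucbr f -> L f g = L f h.
  move=> rf; apply: cst.
    apply: (controls_rucbr _ rf).
    apply: (@controls_lim _ _ _ U _ f (fun n => cesaro n f)) => [n|x].
      exact: (cesaro_controls n rf).
    exact: Lcvg.
  exact: (cesaro_ultralimit_harmonic _ Uoo rf (fun x => Lcvg f x rf)).
have LD f1 f2 g : rucbr f1 -> rucbr f2 ->
    L (fun x => f1 x + f2 x) g = L f1 g + L f2 g.
  move=> r1 r2; apply: LE; under eq_fun do rewrite cesaroD//.
  by apply: cvgD; exact: Lcvg.
have LZ a f g : rucbr f -> L (fun x => a * f x) g = a * L f g.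
  move=> rf; apply: LE; under eq_fun do rewrite cesaroZ//.
  by apply: cvgM; [exact: cvg_cst|exact: Lcvg].
have Lc c g : L (fun=> c) g = c.
  by apply: LE; under eq_fun do rewrite cesaro_cst; exact: cvg_cst.
pose m (F : RUCB R G) : R[i] := L (fun x => complex.Re (F x)) 1%g +i*
  L (fun x => complex.Im (F x)) 1%g.
exists m.
  split.
  - move=> [a b] F1 F2.
    have [r1 i1] := (rucbr_Re F1, rucbr_Im F1).
    have [r2 i2] := (rucbr_Re F2, rucbr_Im F2).
    apply/eqP; rewrite eq_complex; apply/andP; split; apply/eqP.
      have -> : complex.Re (m ((a +i* b) *: F1 + F2)) =
        L (fun x => (a * complex.Re (F1 x) + - b * complex.Im (F1 x)) +
            complex.Re (F2 x)) 1%g.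
        congr (L _ _); apply/funext => x.
        rewrite [(_ *: F1 + F2) x](_ : _ = (a +i* b) * F1 x + F2 x)//.
        by case: (F1 x) (F2 x) => ? ? [] ? ? /=; rewrite mulNr.
      rewrite LD//; last by apply: rucbrD; exact: rucbrZ.
      by rewrite LD ?LZ//= ?mulNr//; exact: rucbrZ.
    have -> : complex.Im (m ((a +i* b) *: F1 + F2)) =
      L (fun x => (a * complex.Im (F1 x) + b * complex.Re (F1 x)) +
          complex.Im (F2 x)) 1%g.
      congr (L _ _); apply/funext => x.
      rewrite [(_ *: F1 + F2) x](_ : _ = (a +i* b) * F1 x + F2 x)//.
      by case: (F1 x) (F2 x) => ? ? [].
    rewrite LD//; last by apply: rucbrD; exact: rucbrZ.
    by rewrite LD ?LZ//; exact: rucbrZ.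
  - move=> F F0; rewrite /m.
    have -> : (fun x => complex.Im (F x)) = fun=> 0.
      apply/funext => x; have := F0 x.
      by case: (F x) => ? ?; rewrite lecE => /andP[/eqP].
    rewrite Lc lecE /= eqxx /=; apply: limr_ge; first exact/cvgU/rucbr_Re.
    apply: nearW => n; apply: cesaro_ge0; first exact: rucbr_Re.
    by move=> x; have := F0 x; case: (F x) => ? ?; rewrite lecE => /andP[].
  - by rewrite /m /= !Lc.
move=> F g; rewrite /m /=.
have LT f : rucbr f -> L (fun x => f (g * x)%g) 1%g = L f 1%g.
  move=> rf; rewrite [RHS](Linv f 1%g g)//; apply: LE.
  by under eq_fun do rewrite cesaro_ltrans; exact: Lcvg.
by rewrite (LT (fun x => complex.Re (F x)) (rucbr_Re F))
  (LT (fun x => complex.Im (F x)) (rucbr_Im F)).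
Qed.

End cesaro.

End amenability_of_liouville.

(** * The Hahn-Banach theorem *)

Section hahn_banach.
Context (R : realType) (V : lmodType R) (S : set V).
Hypotheses (SD : forall x y, S x -> S y -> S (x + y))
  (SZ : forall (a : R) x, S x -> S (a *: x)).

(** Relative to a subspace given as a set, here later the bounded functions among all functions. One
    inequality suffices for scaling: [sublinear_ge] derives the reverse one by scaling back. *)
Definition sublinear_on (q : V -> R) :=
  (forall x y, S x -> S y -> q (x + y) <= q x + q y) /\
  (forall (a : R) x, 0 < a -> S x -> q (a *: x) <= a * q x).

Lemma sublinear_ge q (t : R) x : 0 <= t -> sublinear_on q -> S x ->
  t * q x <= q (t *: x).
Proof.
move=> t0 [qD qZ] Sx; have S0 : S 0 by rewrite -(scale0r x); exact: SZ.
move: t0; rewrite le_eqVlt => /predU1P[<-|t0].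
  by rewrite scale0r mul0r; have := qD _ _ S0 S0; rewrite addr0; lra.
rewrite -ler_pdivlMl//; apply: le_trans (qZ _ _ _ (SZ t Sx)).
  by rewrite scalerA mulVf ?gt_eqF// scale1r.
by rewrite invr_gt0.
Qed.

Lemma sublinear_opp q x : sublinear_on q -> S x -> - q (- x) <= q x.
Proof.
move=> sq Sx; have SNx : S (- x) by rewrite -scaleN1r; exact: SZ.
have := sq.1 _ _ Sx SNx; rewrite subrr => h.
have := sublinear_ge (lexx 0) sq Sx; rewrite scale0r mul0r => h0.
by rewrite lerNl -subr_ge0 opprK addrC (le_trans h0).
Qed.

(* A minimal sublinear functional below p is linear.                         *)
Lemma hahn_banach (p : V -> R) : sublinear_on p -> exists q : V -> R,
  [/\ forall x y, S x -> S y -> q (x + y) = q x + q y,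
      forall a x, S x -> q (a *: x) = a * q x &
      forall x, S x -> q x <= p x].
Proof.
move=> sp; pose T := {q : V -> R | sublinear_on q /\ forall x, S x -> q x <= p x}.
(* The order is reversed, so that Zorn's lemma yields a minimal functional. *)
pose le (q r : T) := `[< forall x, S x -> sval r x <= sval q x >].
have SN x : S x -> S (- x) by rewrite -scaleN1r; exact: SZ.
have [|||[q [sq qp]] qmin] :=
  @ZL_preorder T (exist _ p (conj sp (fun _ _ => lexx _))) le.
- by move=> t; apply/asboolP.
- move=> r s t /asboolP rs /asboolP st; apply/asboolP => x Sx.
  exact: le_trans (st _ Sx) (rs _ Sx).
- move=> A tA; have [A0|/set0P[t0 At0]] := eqVneq A set0.
    by exists (exist _ p (conj sp (fun _ _ => lexx _))) => s; rewrite A0.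
  (* A chain is bounded by its pointwise infimum, which is finite since every value at x is at least
     -p(-x). *)
  pose B x := [set sval s x | s in A].
  have infB x : S x -> has_inf (B x).
    move=> Sx; split; first by exists (sval t0 x), t0.
    exists (- p (- x)) => _ [[s [ss sle]] _ <-] /=.
    by rewrite (le_trans _ (sublinear_opp ss Sx))// lerN2 sle//; exact: SN.
  pose r x := inf (B x).
  have rle s x : A s -> S x -> r x <= sval s x.
    by move=> As Sx; apply: ge_inf; [exact: (infB _ Sx).2|exists s].
  have sr : sublinear_on r.
    split=> [x y Sx Sy|a x a0 Sx].
      rewrite -lerBlDr; apply: lb_le_inf; first exact: (infB _ Sx).1.
      move=> _ [s1 As1 <-]; rewrite lerBlDr -lerBlDl.
      apply: lb_le_inf; first exact: (infB _ Sy).1.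
      move=> _ [s2 As2 <-]; rewrite lerBlDl.
      have [/asboolP h|/asboolP h] := tA _ _ As1 As2.
        apply: le_trans (rle _ _ As2 (SD Sx Sy)) _.
        apply: le_trans ((svalP s2).1.1 _ _ Sx Sy) _.
        by rewrite lerD2r h.
      apply: le_trans (rle _ _ As1 (SD Sx Sy)) _.
      apply: le_trans ((svalP s1).1.1 _ _ Sx Sy) _.
      by rewrite lerD2l h.
    rewrite -ler_pdivrMl//; apply: lb_le_inf; first exact: (infB _ Sx).1.
    move=> _ [s As <-]; rewrite ler_pdivrMl//.
    apply: le_trans (rle _ _ As (SZ a Sx)) _.
    exact: (svalP s).1.2.
  have rp x : S x -> r x <= p x.
    by move=> Sx; rewrite (le_trans (rle _ _ At0 Sx))//; exact: (svalP t0).2.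
  by exists (exist _ r (conj sr rp)) => s As; apply/asboolP => x; exact: rle.
have q0 : forall x, S x -> q 0 = 0.
  move=> x Sx; have S0 : S 0 by rewrite -(scale0r x); exact: SZ.
  apply/eqP; rewrite eq_le; apply/andP; split.
    have := sq.2 2^-1 _ _ S0; rewrite scaler0 invr_gt0 ltr0n => /(_ isT); lra.
  by have := sq.1 _ _ S0 S0; rewrite addr0; lra.
have qD x v : S x -> S v -> q (x + v) = q x + q v.
  move=> Sx Sv; apply/eqP; rewrite eq_le sq.1//=.
  (* The infimum [r y] of q (y + t v) - t q v over t >= 0 is sublinear and below [q], so q <= r by
     minimality; t = 1 then gives q x + q v <= q (x + v). *)
  pose B x := [set q (x + t *: v) - t * q v | t in [set t : R | 0 <= t]].
  have infB y : S y -> has_inf (B y).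
    move=> Sy; split; first by exists (q (y + 0 *: v) - 0 * q v), 0 => //=.
    exists (- q (- y)) => _ [t t0 <-].
    have Stv := SZ t Sv; have := sq.1 _ _ (SD Sy Stv) (SN _ Sy).
    rewrite addrAC subrr add0r; have := sublinear_ge t0 sq Sv; lra.
  pose r y := inf (B y).
  have rle y (t : R) : S y -> 0 <= t -> r y <= q (y + t *: v) - t * q v.
    by move=> Sy t0; apply: ge_inf; [exact: (infB _ Sy).2|exists t].
  have sr : sublinear_on r.
    split=> [y z Sy Sz|a y a0 Sy].
      rewrite -lerBlDr; apply: lb_le_inf; first exact: (infB _ Sy).1.
      move=> _ [s s0 <-]; rewrite lerBlDr -lerBlDl.
      apply: lb_le_inf; first exact: (infB _ Sz).1.
      move=> _ [t t0 <-]; rewrite lerBlDl.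
      have := rle _ _ (SD Sy Sz) (addr_ge0 s0 t0).
      have := sq.1 _ _ (SD Sy (SZ s Sv)) (SD Sz (SZ t Sv)).
      by rewrite addrACA -scalerDl mulrDl; lra.
    rewrite -ler_pdivrMl//; apply: lb_le_inf; first exact: (infB _ Sy).1.
    move=> _ [t t0 <-]; rewrite ler_pdivrMl//.
    have := rle _ _ (SZ a Sy) (mulr_ge0 (ltW a0) t0).
    have := sq.2 _ _ a0 (SD Sy (SZ t Sv)).
    by rewrite scalerDr scalerA mulrBr mulrA; lra.
  have rq y : S y -> r y <= q y.
    by move=> Sy; have := rle _ _ Sy (lexx 0); rewrite scale0r mul0r addr0 subr0.
  have rp y : S y -> r y <= p y by move=> Sy; exact: le_trans (rq _ Sy) (qp _ Sy).
  have := qmin (exist _ r (conj sr rp)) => /(_ _)/asboolP H.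
  have {}H := H (asboolT rq) _ Sx.
  have := rle _ _ Sx ler01; rewrite /= scale1r mul1r in H *; lra.
have qN x : S x -> q (- x) = - q x.
  move=> Sx; have := qD _ _ Sx (SN _ Sx); rewrite subrr (q0 _ Sx) => /esym/eqP.
  by rewrite addrC addr_eq0 => /eqP.
have qZ (a : R) x : 0 < a -> S x -> q (a *: x) = a * q x.
  move=> a0 Sx; apply/eqP; rewrite eq_le sq.2//=.
  exact: sublinear_ge (ltW a0) sq Sx.
exists q; split=> // a x Sx; have [a0|a0|->] := ltgtP a 0.
- rewrite -[a]opprK scaleNr qN; last exact: SZ.
  by rewrite qZ ?mulNr// oppr_gt0.
- exact: qZ.
- by rewrite scale0r mul0r (q0 _ Sx).
Qed.

End hahn_banach.

(** * Separating convex combinations from zero *)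

Section separation.
Context (R : realType) (I X : Type) (S : set I).
Variables (psi : X -> I -> R^o) (delta : R).

Definition bounded_on (phi : I -> R^o) :=
  exists B : R, forall i, S i -> `|phi i| <= B.

Definition combination (w : seq (R * X)) (i : I) : R :=
  \sum_(ax <- w) ax.1 * psi ax.2 i.

Definition total_weight (w : seq (R * X)) : R := \sum_(ax <- w) ax.1.

Definition nonneg_weights (w : seq (R * X)) := all (fun ax => 0 <= ax.1) w.

Definition rescale (a : R) (w : seq (R * X)) := [seq (a * bx.1, bx.2) | bx <- w].

Lemma combination_cat w1 w2 i :
  combination (w1 ++ w2) i = combination w1 i + combination w2 i.
Proof. by rewrite /combination big_cat. Qed.

Lemma total_weight_cat w1 w2 :
  total_weight (w1 ++ w2) = total_weight w1 + total_weight w2.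
Proof. by rewrite /total_weight big_cat. Qed.

Lemma combination_rescale a w i :
  combination (rescale a w) i = a * combination w i.
Proof.
rewrite /combination big_map mulr_sumr.
by apply: eq_bigr => bx _; rewrite mulrA.
Qed.

Lemma total_weight_rescale a w : total_weight (rescale a w) = a * total_weight w.
Proof. by rewrite /total_weight big_map mulr_sumr. Qed.

Lemma nonneg_rescale a w : 0 <= a -> nonneg_weights w ->
  nonneg_weights (rescale a w).
Proof.
move=> a0; rewrite /nonneg_weights all_map; apply: sub_all => bx.
exact: mulr_ge0.
Qed.

Lemma total_weight_ge0 w : nonneg_weights w -> 0 <= total_weight w.
Proof.
rewrite /total_weight; elim: w => [|ax w IH] /=; first by rewrite big_nil.
by move=> /andP[a0 /IH w0]; rewrite big_cons addr_ge0.
Qed.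

(** Hahn-Banach for p(phi), the infimum of the c such that some nonnegative combination of the
    [psi x], of weight W, brings phi within c + delta W of zero on [S]. The hypothesis on
    combinations keeps p finite, p is at most the supremum norm on [S], and p(-psi x) <= -delta. *)
Lemma finite_separation (x0 : X) : (forall x, bounded_on (psi x)) ->
  (forall w, nonneg_weights w -> total_weight w = 1 ->
    exists2 i, S i & delta < `|combination w i|) ->
  exists theta : (I -> R^o) -> R,
  [/\ forall phi1 phi2, bounded_on phi1 -> bounded_on phi2 ->
        theta (phi1 + phi2) = theta phi1 + theta phi2,
      forall a phi, bounded_on phi -> theta (a *: phi) = a * theta phi,
      forall phi B, (forall i, S i -> `|phi i| <= B) -> theta phi <= B &
      forall x, delta <= theta (psi x)].
Proof.
move=> bpsi far.
have bD phi1 phi2 : bounded_on phi1 -> bounded_on phi2 -> bounded_on (phi1 + phi2).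
  move=> [B1 h1] [B2 h2]; exists (B1 + B2) => i Si.
  by rewrite (le_trans (ler_normD _ _))// lerD ?h1 ?h2.
have bZ a phi : bounded_on phi -> bounded_on (a *: phi).
  by move=> [B h]; exists (`|a| * B) => i Si; rewrite normrM ler_wpM2l ?h.
pose P (phi : I -> R^o) := [set c | exists2 w, nonneg_weights w &
  forall i, S i -> `|phi i + combination w i| <= c + delta * total_weight w].
have combnil i : combination [::] i = 0 by rewrite /combination big_nil.
have twnil : total_weight [::] = 0 by rewrite /total_weight big_nil.
have PB phi B : (forall i, S i -> `|phi i| <= B) -> P phi B.
  by move=> h; exists [::] => // i Si; rewrite combnil twnil mulr0 !addr0 h.
have [i0 Si0] : exists i, S i.
  have [||i Si _] := far [:: (1, x0)]; last by exists i.
    by rewrite /nonneg_weights /= ler01.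
  by rewrite /total_weight big_seq1.
have Plb phi B c : (forall i, S i -> `|phi i| <= B) -> P phi c -> - B <= c.
  move=> h [w w0 hw]; have := total_weight_ge0 w0.
  rewrite le_eqVlt => /predU1P[W0|W0].
    have := hw _ Si0; rewrite -W0 mulr0 addr0 => /(le_trans (normr_ge0 _)) c0.
    by rewrite (le_trans _ c0)// oppr_le0 (le_trans _ (h _ Si0)).
  have [||i Si] := far (rescale (total_weight w)^-1 w).
  - by apply: nonneg_rescale => //; rewrite invr_ge0 ltW.
  - by rewrite total_weight_rescale mulVf ?gt_eqF.
  rewrite combination_rescale normrM gtr0_norm ?invr_gt0// mulrC ltr_pdivlMr//.
  move=> /ltW lw; rewrite lerNl.
  have : `|combination w i| <= `|phi i + combination w i| + `|phi i|.
    rewrite -[X in `|X| <= _](addKr (phi i)) addrC.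
    exact: ler_normB.
  have := hw _ Si; have := h _ Si; lra.
have infP phi : bounded_on phi -> has_inf (P phi).
  by move=> [B h]; split; [exists B; exact: PB|exists (- B) => c; exact: Plb].
pose p phi := inf (P phi).
have ple phi c : bounded_on phi -> P phi c -> p phi <= c.
  by move=> bphi Pc; apply: ge_inf => //; exact: (infP _ bphi).2.
have sp : sublinear_on bounded_on p.
  split=> [phi1 phi2 b1 b2|a phi a0 b].
    rewrite -lerBlDr; apply: lb_le_inf; first exact: (infP _ b1).1.
    move=> c1 [w1 w10 h1]; rewrite lerBlDr -lerBlDl.
    apply: lb_le_inf; first exact: (infP _ b2).1.
    move=> c2 [w2 w20 h2]; rewrite lerBlDl; apply: ple; first exact: bD.
    exists (w1 ++ w2); first by rewrite /nonneg_weights all_cat; apply/andP.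
    move=> i Si; rewrite combination_cat total_weight_cat.
    have -> : c1 + c2 + delta * (total_weight w1 + total_weight w2) =
      (c1 + delta * total_weight w1) + (c2 + delta * total_weight w2) by ring.
    rewrite (le_trans _ (lerD (h1 _ Si) (h2 _ Si)))//.
    apply: le_trans (ler_normD _ _).
    by rewrite [(phi1 + phi2) i](_ : _ = phi1 i + phi2 i)// addrACA.
  rewrite -ler_pdivrMl//; apply: lb_le_inf; first exact: (infP _ b).1.
  move=> c [w w0 h]; rewrite ler_pdivrMl//; apply: ple; first exact: bZ.
  exists (rescale a w); first by apply: nonneg_rescale => //; exact: ltW.
  move=> i Si; rewrite combination_rescale total_weight_rescale mulrCA -!mulrDr.
  by rewrite normrM gtr0_norm// ler_pM2l// h.
have [theta [tD tZ tp]] := hahn_banach bD bZ sp.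
exists theta; split=> // [phi B h|x].
  have b : bounded_on phi by exists B.
  by apply: le_trans (tp _ b) _; apply: ple => //; exact: PB.
have bN : bounded_on (- 1 *: psi x) by exact: bZ.
have : theta (- 1 *: psi x) <= - delta.
  apply: le_trans (tp _ bN) _; apply: ple => //.
  exists [:: (1, x)]; first by rewrite /nonneg_weights /= ler01.
  move=> i Si; rewrite /combination /total_weight !big_seq1 /= mulr1 mul1r addNr.
  by rewrite [_ i](_ : _ = -1 * psi x i)// mulN1r addNr normr0.
by rewrite tZ// mulN1r lerN2.
Qed.

End separation.

(** * Almost invariant probabilities with finite support *)

(* An alias, so that G itself does not inherit the uniform structure.        *)
Definition right_uniform (G : topologicalGroupType) : Type := G.

Section right_uniformity.
Context (G : topologicalGroupType).
Notation T := (right_uniform G).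

HB.instance Definition _ := Choice.on T.

Definition right_entourage : set_system (T * T) :=
  [set A | exists2 U : set G, nbhs (1%g : G) U &
     forall x y : G, U (x * y^-1)%g -> A (x, y)].

Let right_entourage_filter : Filter right_entourage.
Proof.
split=> [|A B [U U1 UA] [V V1 VB]|A B AB [U U1 UA]].
- by exists setT => //; exact: filterT.
- exists (U `&` V); first exact: filterI.
  by move=> x y [/UA ? /VB ?].
- by exists U => // x y /UA /AB.
Qed.

Let right_entourage_diagonal A : right_entourage A -> diagonal `<=` A.
Proof.
move=> [U U1 UA] [x y]; rewrite /diagonal /= => ->; apply: UA.
by rewrite mulgV; exact: nbhs_singleton.
Qed.

Let right_entourage_inv A : right_entourage A -> right_entourage (A^-1)%relation.
Proof.
move=> [U U1 UA]; exists [set x | U (x^-1)%g].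
  by apply: invg_continuous; rewrite invg1.
by move=> x y /=; rewrite invgM invgK; exact: UA.
Qed.

Let right_entourage_split A : right_entourage A ->
  exists2 B, right_entourage B & (B \; B `<=` A)%relation.
Proof.
move=> [U U1 UA].
have : nbhs ((1, 1)%g : G * G) ((fun xy : G * G => (xy.1 * xy.2)%g) @^-1` U).
  by apply: (@mulg_continuous G (1, 1)%g); rewrite /= mulg1.
move=> [[V W] /= [V1 W1] VWU].
exists [set xy : T * T | (V `&` W) ((xy.1 : G) * (xy.2 : G)^-1)%g].
  by exists (V `&` W) => //; exact: filterI.
move=> [x z] [y /= [Vxy _] [_ Wyz]]; apply: UA.
by have := VWU (_, _) (conj Vxy Wyz); rewrite /= mulgA mulgVK.
Qed.

HB.instance Definition _ := isUniform.Build T right_entourage_filter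
  right_entourage_diagonal right_entourage_inv right_entourage_split.

(** The basic neighbourhoods of 1 give a countable base of entourages, from which a pseudometric is
    obtained. *)
Lemma right_uniform_countable : @second_countable G -> countable_uniformity T.
Proof.
move=> [B cB [Bo nB]].
exists [set [set xy : T * T | U ((xy.1 : G) * (xy.2 : G)^-1)%g] |
  U in B `&` [set U | U 1%g]].
split.
- apply: sub_countable (card_image_le _ _) _.
  exact: (sub_countable (subset_card_le (@subIsetl _ _ _)) cB).
- move=> _ [U [BU U1] <-]; exists U => //.
  by apply: open_nbhs_nbhs; split=> //; exact: Bo.
- move=> P [U U1 UP]; have [V [BV V1] VU] := nB _ _ U1.
  exists [set xy : T * T | V ((xy.1 : G) * (xy.2 : G)^-1)%g]; first by exists V.
  by move=> [x y] /= /VU; exact: UP.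
Qed.

End right_uniformity.

(** * Lipschitz functions for the right uniformity *)

Section lipschitz.
Context (R : realType) (G : topologicalGroupType).
Hypothesis countableG : @second_countable G.

Let T := @countable_uniform.type _ (right_uniform_countable countableG).

Definition right_ball : G -> R -> G -> Prop := @ball R T.

Lemma right_ball_nbhs e : 0 < e -> exists2 U : set G, nbhs (1%g : G) U &
  forall x y, U (x * y^-1)%g -> right_ball x e y.
Proof.
by move=> e0; exact: (@entourage_ball R T (PosNum e0)).
Qed.

Lemma nbhs_right_ball (U : set G) : nbhs (1%g : G) U -> exists2 e, 0 < e &
  forall x y, right_ball x e y -> U (x * y^-1)%g.
Proof.
move=> U1.
have : entourage_ (@ball R T)
    [set xy | U ((xy.1 : G) * (xy.2 : G)^-1)%g].
  by rewrite entourage_ballE; exists U.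
move=> [e /= e0 eU]; exists e => // x y xy.
exact: (eU (x, y)).
Qed.

Lemma right_ball_refl x e : 0 < e -> right_ball x e x.
Proof. by move=> e0; exact: (@ballxx R T x e e0). Qed.

Lemma right_ball_sym x y e : right_ball x e y -> right_ball y e x.
Proof. exact: ball_sym. Qed.

Lemma right_ball_triangle x y z d e :
  right_ball x d y -> right_ball y e z -> right_ball x (d + e) z.
Proof. exact: ball_triangle. Qed.

Lemma right_ball_le x y d e : d <= e -> right_ball x d y -> right_ball x e y.
Proof. by move=> de; apply: le_ball. Qed.

(** A class with one common modulus, so that applying a functional of norm at most one to
    evaluations on the class gives RUCB functions again. Its multiples approximate RUCB uniformly
    ([lipschitz1_dense]). *)
Definition lipschitz1 (h : G -> R) := bounded_by h 1 /\
  forall x y e, 0 < e -> right_ball x e y -> `|h x - h y| <= e.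

Lemma lipschitz1_rucbr h : lipschitz1 h -> rucbr h.
Proof.
move=> [h1 lh]; split; first by exists 1.
move=> e e0; have [U U1 Ue] := right_ball_nbhs e0.
by exists U => // x y /Ue; exact: lh.
Qed.

(* C * h is the sup-convolution of f with a multiple of the pseudometric.    *)
Lemma lipschitz1_dense f (eps : R) : rucbr f -> 0 < eps ->
  exists2 h, lipschitz1 h &
    exists2 C : R, 0 < C & forall x, `|f x - C * h x| <= eps.
Proof.
move=> [[M fM] uf] eps0; have [U U1 Uf] := uf _ eps0.
have [e e0 eU] := nbhs_right_ball U1.
have M0 : 0 <= M by rewrite (le_trans _ (fM 1%g)).
(* With this slope, going beyond distance e costs at least 2M, which bounds the oscillation of
   [f]. *)
pose N := 2 * M / e + 1.
have N0 : 0 < N by rewrite /N ltr_wpDl// divr_ge0 ?mulr_ge0 ?(ltW e0).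
have Ne : 2 * M <= N * e.
  by rewrite /N [leRHS]mulrDl mul1r divfK ?gt_eqF// lerDl ltW.
have fle x : - M <= f x <= M by rewrite -ler_norml.
pose B x := [set f yr.1 - N * yr.2 | yr in
  [set yr : G * R | 0 < yr.2 /\ right_ball x yr.2 yr.1]].
have BM x : ubound (B x) M.
  move=> _ [[y r] /= [r0 _] <-]; have /andP[_ fy] := fle y.
  by rewrite lerBlDr (le_trans fy)// lerDl mulr_ge0// ltW.
have supB x : has_sup (B x).
  split; last by exists M; exact: BM.
  by exists (f x - N * 1), (x, 1) => //=; split=> //; exact: right_ball_refl.
pose F x := sup (B x).
have leF x y r : 0 < r -> right_ball x r y -> f y - N * r <= F x.
  by move=> r0 xy; apply: ub_le_sup; [exact: (supB x).2|exists (y, r)].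
have fF x : f x <= F x.
  apply/ler_addgt0Pr => d d0; rewrite -lerBlDr.
  have dN : N * (d / N) = d by rewrite mulrC divfK ?gt_eqF.
  rewrite -{1}dN; apply: leF; first by rewrite divr_gt0.
  by apply: right_ball_refl; rewrite divr_gt0.
have Ff x : F x <= f x + eps.
  apply: ge_sup; first exact: (supB x).1.
  move=> _ [[y r] /= [r0 xy] <-]; have [re|er] := leP r e.
    have := Uf _ _ (eU _ _ (right_ball_le re xy)); rewrite ler_norml => /andP[h _].
    have := mulr_ge0 (ltW N0) (ltW r0); lra.
  have /andP[_ fy] := fle y; have /andP[fx _] := fle x.
  have : N * e <= N * r by rewrite ler_pM2l// ltW.
  lra.
have FM x : `|F x| <= M.
  rewrite ler_norml; have /andP[fx _] := fle x; rewrite (le_trans fx (fF x)) /=.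
  by apply: ge_sup; [exact: (supB x).1|exact: BM].
have lipF x y r : 0 < r -> right_ball x r y -> F x <= F y + N * r.
  move=> r0 xy; apply: ge_sup; first exact: (supB x).1.
  move=> _ [[z s] /= [s0 xz] <-].
  have := leF _ _ _ (addr_gt0 r0 s0) (right_ball_triangle (right_ball_sym xy) xz).
  by rewrite mulrDr; lra.
(* Dividing by N + M brings both the bound M and the Lipschitz constant N down to at most 1. *)
have C0 : 0 < N + M by rewrite ltr_pwDl.
exists (fun x => F x / (N + M)).
  split=> [x|x y r r0 xy].
    rewrite normrM [X in _ * X]gtr0_norm ?invr_gt0// ler_pdivrMr// mul1r.
    by rewrite (le_trans (FM x))// lerDr ltW.
  rewrite -mulrBl normrM [X in _ * X]gtr0_norm ?invr_gt0// ler_pdivrMr//.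
  apply: (@le_trans _ _ (N * r)); last first.
    by rewrite mulrC ler_wpM2l ?(ltW r0)// lerDl.
  rewrite ler_norml; have := lipF _ _ _ r0 xy.
  have := lipF _ _ _ r0 (right_ball_sym xy).
  by move=> h1 h2; apply/andP; split; lra.
exists (N + M) => // x; rewrite [_ * (_ / _)]mulrC divfK ?gt_eqF//.
have := fF x; have := Ff x; rewrite ler_norml => h1 h2.
by apply/andP; split; lra.
Qed.

End lipschitz.

(** * From an invariant mean to almost invariant weights *)

Section reiter.
Context (R : realType) (G : topologicalGroupType).
Hypothesis countableG : @second_countable G.

Definition average (w : seq (R * G)) (h : G -> R) (g : G) : R :=
  \sum_(ax <- w) ax.1 * h (g * ax.2)%g.

(** If no weights work, no convex combination of the functions (g, h) -> h (g x) - h x is small, and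
    [finite_separation] gives a [theta] that is at least eps on all of them. Read as a function of
    x, this is a sum of differences between translates of RUCB functions and the functions
    themselves; an invariant mean kills it. *)
Lemma lipschitz1_almost_invariant (E : seq G) (eps : R) : amenable R G -> 0 < eps ->
  exists w, [/\ nonneg_weights w, total_weight w = 1 &
    forall h g, lipschitz1 countableG h -> g \in E ->
      `|average w h g - average w h 1%g| <= eps].
Proof.
move=> [m [ml mpos m1] minv] eps0.
pose I := (G * (G -> R))%type.
pose S := [set i : I | i.1 \in E /\ lipschitz1 countableG i.2].
pose phi (g y : G) : I -> R^o := fun i => (i.1 == g)%:R * i.2 y.
(* A sum of slices, one for each g, lets [theta] be distributed over g; [undup] keeps a repeated g
   from counting twice. *)
pose psi (x : G) : I -> R^o := \sum_(g <- undup E) (phi g (g * x)%g - phi g x).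
have psiE x i : S i -> psi x i = i.2 (i.1 * x)%g - i.2 x.
  move=> [iE _]; rewrite /psi fct_sumE (bigD1_seq i.1) ?mem_undup ?undup_uniq//=.
  rewrite [X in X + _](_ : _ = i.2 (i.1 * x)%g - i.2 x); last first.
    by rewrite [LHS](_ : _ = phi i.1 (i.1 * x)%g i - phi i.1 x i)// /phi eqxx !mul1r.
  rewrite big1 ?addr0// => g gi.
  rewrite [LHS](_ : _ = phi g (g * x)%g i - phi g x i)// /phi.
  by rewrite eq_sym (negbTE gi) !mul0r subrr.
have phi_le1 g y i : S i -> `|phi g y i| <= 1.
  move=> [_ [i1 _]]; rewrite /phi; case: eqP => _; rewrite ?mul1r ?mul0r ?normr0//.
have bphi g y : bounded_on S (phi g y) by exists 1; exact: phi_le1.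
have bD (phi1 phi2 : I -> R^o) : bounded_on S phi1 -> bounded_on S phi2 ->
    bounded_on S (phi1 + phi2).
  move=> [B1 h1] [B2 h2]; exists (B1 + B2) => i Si.
  by rewrite (le_trans (ler_normD _ _))// lerD ?h1 ?h2.
have bZ a (ph : I -> R^o) : bounded_on S ph -> bounded_on S (a *: ph).
  by move=> [B h]; exists (`|a| * B) => i Si; rewrite normrM ler_wpM2l ?h.
have bB (phi1 phi2 : I -> R^o) : bounded_on S phi1 -> bounded_on S phi2 ->
    bounded_on S (phi1 - phi2).
  by move=> b1 b2; apply: bD => //; rewrite -scaleN1r; exact: bZ.
have b0 : bounded_on S (0 : I -> R^o) by exists 0 => i _; rewrite normr0.
have bsum (s : seq G) x : bounded_on S (\sum_(g <- s) (phi g (g * x)%g - phi g x)).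
  by elim/big_ind : _ => // g _; exact: bB.
apply: contrapT => noW.
have far w : nonneg_weights w -> total_weight w = 1 ->
    exists2 i, S i & eps < `|combination psi w i|.
  move=> w0 w1; apply: contrapT => noi; apply: noW; exists w; split=> // h g lh gE.
  rewrite leNgt; apply/negP => lt_eps; apply: noi; exists (g, h) => //.
  rewrite (_ : combination _ _ _ = average w h g - average w h 1%g)//.
  rewrite /combination /average -sumrB; apply: eq_bigr => ax _.
  by rewrite psiE//= mul1g mulrBr.
have [theta [tD tZ tB tpsi]] :=
  finite_separation 1%g (fun x => bsum (undup E) x) far.
have tBr (phi1 phi2 : I -> R^o) : bounded_on S phi1 -> bounded_on S phi2 ->
    theta (phi1 - phi2) = theta phi1 - theta phi2.
  move=> b1 b2; rewrite -scaleN1r tD ?tZ ?mulN1r//; exact: bZ.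
have tN (ph : I -> R^o) B : (forall i, S i -> `|ph i| <= B) -> `|theta ph| <= B.
  move=> h; have b : bounded_on S ph by exists B.
  rewrite ler_norml lerNl (tB _ _ h) andbT -mulN1r -tZ//; apply: tB => i Si.
  by rewrite [(_ *: ph) i](_ : _ = -1 * ph i)// mulN1r normrN h.
have theta0 : theta 0 = 0.
  by have := tZ 0 0 b0; rewrite scale0r mul0r.
(* Evaluations at nearby points are uniformly close on [S], so these functions are Lipschitz and the
   mean applies to them. *)
pose F (g y : G) : R := theta (phi g y).
have lipF g : lipschitz1 countableG (F g).
  split=> [y|x y e e0 xy]; first by apply: tN => i; exact: phi_le1.
  rewrite /F -tBr//; apply: tN => i Si.
  rewrite [(_ - _) i](_ : _ = phi g x i - phi g y i)// /phi -mulrBr normrM.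
  have := Si.2.2 _ _ _ e0 xy; case: eqP => _;
    rewrite ?normr1 ?normr0 ?mul1r ?mul0r//.
  by move=> _; exact: ltW.
have rF g := lipschitz1_rucbr (lipF g).
pose Z (s : seq G) : RUCB R G :=
  \sum_(g <- s) (RUCB_ltrans g (RUCB_of_real (rF g)) - RUCB_of_real (rF g)).
have m0 : m 0 = 0.
  by have := ml (-1) 0 0; rewrite scaler0 addr0 mulN1r addNr.
have mD a b : m (a + b) = m a + m b by have := ml 1 a b; rewrite scale1r mul1r.
have mN a : m (- a) = - m a.
  by have := ml (-1) a 0; rewrite scaleN1r addr0 m0 addr0 mulN1r.
have mZ s : m (Z s) = 0.
  rewrite /Z; elim: s => [|g s IH]; first by rewrite big_nil.
  by rewrite big_cons mD IH addr0 mD mN minv subrr.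
have ZE s x : Z s x = (theta (\sum_(g <- s) (phi g (g * x)%g - phi g x)))%:C.
  rewrite /Z; elim: s => [|g s IH].
    by rewrite !big_nil theta0.
  rewrite !big_cons tD; [|exact: bB|exact: bsum].
  rewrite [LHS](_ : _ = ((F g (g * x)%g)%:C - (F g x)%:C) + Z s x)//.
  by rewrite IH tBr// -rmorphB -rmorphD.
(* [Z (undup E)] is at least eps everywhere, yet its mean is 0. *)
have : 0 <= m (Z (undup E) - eps%:C *: RUCB_one R G).
  apply: mpos => x.
  rewrite [leRHS](_ : _ = Z (undup E) x - eps%:C * 1)// mulr1 ZE -rmorphB.
  by have := tpsi x; rewrite -subr_ge0 -ler0c.
have -> : m (Z (undup E) - eps%:C *: RUCB_one R G) = - eps%:C.
  rewrite mD mZ add0r mN; congr (- _).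
  by have := ml eps%:C (RUCB_one R G) 0; rewrite addr0 m0 addr0 m1 mulr1.
by rewrite oppr_ge0 -[0]/(0%:C) lecR leNgt eps0.
Qed.

End reiter.

(** * Atomic probabilities *)

Section atomic_probability.
Context (R : realType) (G : topologicalGroupType).
Variables (c : nat -> {nonneg R}) (a : nat -> G).
Hypothesis c1 : \sum_(k < n) (c k)%:num @[n --> \oo] --> (1 : R).

Let atom n : {measure set (borel G) -> \bar R} := mscale (c n) \d_(a n : borel G).

Let atomic_setT : mseries atom 0 [set: borel G] = 1%E.
Proof.
rewrite /mseries; apply/cvg_lim => //.
rewrite (_ : (fun n => _) = EFin \o (fun n => \sum_(k < n) (c k)%:num)).
  by apply/cvg_EFin => //; exact: nearW.
apply/funext => n /=; rewrite big_mkord -sumEFin; apply: eq_bigr => k _.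
by rewrite /mscale /= diracT mule1.
Qed.

Let atomic : probability (borel G) R :=
  HB.pack (mseries atom 0) (Measure_isProbability.Build _ _ _ _ atomic_setT).

Let atomicE A :
  (\sum_(k < n) (c k)%:num%:E * \d_(a k : borel G) A)%E @[n --> \oo] --> atomic A.
Proof.
have : cvgn (fun n => \sum_(0 <= k < n) atom k A)%E.
  by apply: is_cvg_nneseries => n _ _; exact: measure_ge0.
rewrite (_ : (fun n => \sum_(k < n) _)%E = fun n => \sum_(0 <= k < n) atom k A)%E//.
by apply/funext => n; rewrite big_mkord.
Qed.

Lemma atomic_probability : exists mu : probability (borel G) R,
  (forall A,
    (\sum_(k < n) (c k)%:num%:E * \d_(a k : borel G) A)%E @[n --> \oo] --> mu A) /\
  (forall f, rucbr f -> forall u,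
    \sum_(k < n) (c k)%:num * f (u * a k)%g @[n --> \oo] --> Phir mu f u).
Proof.
exists atomic; split; first exact: atomicE.
move=> f rf u; have [[M fM] _] := rf.
(* The shift makes the integrand nonnegative, so that integrating against the series of measures is
   termwise; it is undone using total mass 1. *)
pose h := fun x => f x + M.
have h0 x : 0 <= h x by have := fM x; rewrite ler_norml => /andP[]; rewrite /h; lra.
have rh : rucbr h by apply: rucbrD => //; exact: rucbr_cst.
have rhu := rucbr_ltrans u rh.
have fh : Phir atomic f u = Phir atomic h u - M.
  by rewrite PhirD// ?Phir_cst ?addrK//; exact: rucbr_cst.
have intE : (\int[atomic]_x (h (u * x)%g)%:E =
    \sum_(0 <= n <oo) \int[atom n]_x (h (u * x)%g)%:E)%E.
  apply: ge0_integral_measure_series => //.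
  - by move=> x _; rewrite lee_fin.
  - exact: (measurable_int _ (rucbr_integrable atomic rhu)).
have intn n : (\int[atom n]_x (h (u * x)%g)%:E = ((c n)%:num * h (u * a n)%g)%:E)%E.
  rewrite ge0_integral_mscale//.
  - rewrite integral_dirac// ?diracT ?mul1e//.
    exact: (measurable_int _ (rucbr_integrable atomic rhu)).
  - exact: (measurable_int _ (rucbr_integrable atomic rhu)).
  - by move=> x _; rewrite lee_fin.
have hcvg : \sum_(k < n) (c k)%:num * h (u * a k)%g @[n --> \oo] --> Phir atomic h u.
  suff /fine_cvgP[] : (EFin \o (fun n => \sum_(k < n) (c k)%:num * h (u * a k)%g))
      @ \oo --> (Phir atomic h u)%:E by [].
  rewrite [X in _ --> X](_ : _ = (\int[atomic]_x (h (u * x)%g)%:E)%E); last first.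
    rewrite /Phir /Rintegral fineK//.
    exact: (integrable_fin_num measurableT (rucbr_integrable atomic rhu)).
  rewrite intE.
  have : cvgn (fun n => \sum_(0 <= k < n) \int[atom k]_x (h (u * x)%g)%:E)%E.
    apply: is_cvg_nneseries => n _ _; apply: integral_ge0 => x _.
    by rewrite lee_fin.
  rewrite (_ : EFin \o _ = fun n =>
    \sum_(0 <= k < n) \int[atom k]_x (h (u * x)%g)%:E)%E//.
  apply/funext => n; rewrite big_mkord /= -sumEFin.
  by apply: eq_bigr => k _; rewrite intn.
rewrite fh.
rewrite (_ : (fun n => _) = fun n => \sum_(k < n) (c k)%:num * h (u * a k)%g -
    M * \sum_(k < n) (c k)%:num); last first.
  apply/funext => n; rewrite mulr_sumr -sumrB; apply: eq_bigr => k _.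
  by rewrite /h; ring.
rewrite -[X in _ - X](mulr1 M); apply: cvgB => //.
by apply: cvgM => //; exact: cvg_cst.
Qed.

Section atomic_properties.
Variable mu : probability (borel G) R.
Hypothesis muE : forall A,
  (\sum_(k < n) (c k)%:num%:E * \d_(a k : borel G) A)%E @[n --> \oo] --> mu A.

Let partial_le n A : (\sum_(k < n) (c k)%:num%:E * \d_(a k : borel G) A <= mu A)%E.
Proof.
have E k : (\sum_(j < k) (c j)%:num%:E * \d_(a j : borel G) A =
    \sum_(0 <= j < k) (c j)%:num%:E * \d_(a j : borel G) A)%E by rewrite big_mkord.
rewrite -(cvg_lim _ (@muE A))// E (funext E); apply: nneseries_lim_ge => k _ _.
by rewrite mule_ge0// lee_fin.
Qed.

Lemma atomic_gt0 n (U : set G) : 0 < (c n)%:num -> U (a n) -> (0 < mu U)%E.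
Proof.
move=> cn Un; apply: lt_le_trans (partial_le n.+1 U).
rewrite big_ord_recr /= diracE mem_set// mule1.
apply: (@lt_le_trans _ _ (c n)%:num%:E); first by rewrite lte_fin.
by apply: leeDr; apply: sume_ge0 => k _; rewrite mule_ge0// lee_fin.
Qed.

(* The inner approximation of B by the finite sets of its first atoms.       *)
Lemma atomic_regular : hausdorff_space G -> regular_measure mu.
Proof.
move=> hG B mB; apply/eqP; rewrite eq_le; apply/andP; split; last first.
  apply: ge_ereal_sup => _ [K [KB cK] <-]; apply: le_measure; rewrite ?inE//.
  rewrite -[K]setCK; apply: measurableC; apply: sub_sigma_algebra.
  by apply: closed_openC; exact: compact_closed.
have -> : mu B =
    limn (fun n => \sum_(k < n) (c k)%:num%:E * \d_(a k : borel G) B)%E.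
  by apply/esym/cvg_lim.
apply: lime_le; first by apply/cvg_ex; exists (mu B).
apply: nearW => n.
pose K : set G := B `&` [set x | x \in [seq a k | k <- iota 0 n]].
apply: (@le_trans _ _ (mu K)); last first.
  apply: ereal_sup_ubound; exists K => //; split; first exact: subIsetl.
  apply: finite_compact; apply: (sub_finite_set (@subIsetr _ _ _)).
  exact: finite_seq.
apply: le_trans (partial_le n K); apply: lee_sum => k _.
apply: lee_wpmul2l; first by rewrite lee_fin.
rewrite !diracE lee_fin ler_nat; case: (boolP (a k \in B)) => [akB|//].
rewrite mem_set//; split; first exact: set_mem.
by rewrite /=; apply: map_f; rewrite mem_iota /= add0n.
Qed.

End atomic_properties.

End atomic_probability.

(** * The measure of Kaimanovich and Vershik *)

Section enumeration.
Context (T : eqType) (x0 : T) (v : nat -> seq T).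
Hypothesis v0 : forall i, v i != [::].

Let fl K := flatten [seq v i | i <- iota 0 K].

Let flS K : fl K.+1 = fl K ++ v K.
Proof. by rewrite /fl -addn1 iotaD map_cat flatten_cat /= cats0. Qed.

Let fl_prefix K K' : (K <= K')%N -> exists s, fl K' = fl K ++ s.
Proof.
elim: K' => [|K' IH]; first by rewrite leqn0 => /eqP ->; exists [::]; rewrite cats0.
rewrite leq_eqVlt => /predU1P[->|/IH[s sE]]; first by exists [::]; rewrite cats0.
by exists (s ++ v K'); rewrite flS sE catA.
Qed.

Let le_size K : (K <= size (fl K))%N.
Proof.
elim: K => // K IH; rewrite flS size_cat -addn1 leq_add//.
by rewrite lt0n size_eq0.
Qed.

(** As blocks are nonempty, the first n+1 of them have an entry at index n, and appending blocks
    does not move it. [sz K] is the total length of the first K blocks. *)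
Lemma enumerate_blocks : exists (e : nat -> T) (sz : nat -> nat),
  (forall K, (K <= sz K)%N) /\
  forall K, [seq e n | n <- iota 0 (sz K)] = flatten [seq v i | i <- iota 0 K].
Proof.
exists (fun n => nth x0 (fl n.+1) n), (fun K => size (fl K)); split=> // K.
apply: (@eq_from_nth _ x0); first by rewrite size_map size_iota.
move=> n; rewrite size_map size_iota => nK.
rewrite (nth_map 0%N) ?size_iota// nth_iota// add0n -/(fl K).
have [s1 E1] := fl_prefix (leq_maxl n.+1 K).
have [s2 E2] := fl_prefix (leq_maxr n.+1 K).
have := congr1 (fun s => nth x0 s n) (etrans (esym E1) E2).
by rewrite /= !nth_cat nK (leq_trans (ltnSn n) (le_size _)).
Qed.

End enumeration.

Section words.
Context (G : groupType).
Implicit Types (L : seq G) (k : nat).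

(** Products of at most [k] letters; admitting shorter ones makes the list increase with [k]. *)
Fixpoint words L k : seq G :=
  if k is k'.+1 then words L k' ++ [seq (a * v)%g | a <- L, v <- words L k']
  else [:: 1%g].

Lemma words1 L k : 1%g \in words L k.
Proof. by elim: k => [|k IH] /=; rewrite ?inE// mem_cat IH. Qed.

Lemma words_cons L k a v : a \in L -> v \in words L k ->
  (a * v)%g \in words L k.+1.
Proof. by move=> aL vk; rewrite /= mem_cat allpairs_f ?orbT. Qed.

Lemma words_sub L L' k k' : {subset L <= L'} -> (k <= k')%N ->
  {subset words L k <= words L' k'}.
Proof.
move=> LL'; have base n : {subset words L 0 <= words L' n}.
  by move=> x; rewrite [_ \in words L 0]inE => /eqP ->; exact: words1.
elim: k' k => [|k' IH] [|k] // kk' x; try exact: base.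
rewrite /=.
rewrite !mem_cat => /orP[/(IH k kk') ->//|/allpairsP[[a v] /= [aL vk ->]]].
by apply/orP; right; apply: allpairs_f; [exact: LL'|exact: IH vk].
Qed.

End words.

Section liouville_measure.
Context (R : realType) (G : topologicalGroupType).
Hypothesis countableG : @second_countable G.
Hypothesis amenG : amenable R G.

(** Mixing a mass eps/4 at [x] into eps/2-invariant weights adds at most eps/2 to each difference.
    The atom serves full support. *)
Lemma almost_invariant_with_atom (E : seq G) (x : G) (i : nat) :
  exists w : seq (R * G), [/\ nonneg_weights w, total_weight w = 1,
    forall h g, lipschitz1 countableG h -> g \in E ->
      `|average w h g - average w h 1%g| <= i.+1%:R^-1 &
    exists2 eta, 0 < eta & (eta, x) \in w].
Proof.
pose eps : R := i.+1%:R^-1.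
have eps0 : 0 < eps by rewrite invr_gt0.
have eps1 : eps <= 1 by rewrite invf_le1// ler1n.
have [|w [w0 w1 wE]] :=
    lipschitz1_almost_invariant countableG E amenG (_ : 0 < eps / 2).
  by rewrite divr_gt0.
pose eta := eps / 4.
have avgE h g : average ((eta, x) :: rescale (1 - eta) w) h g =
    eta * h (g * x)%g + (1 - eta) * average w h g.
  rewrite /average big_cons; congr (_ + _).
  by rewrite big_map mulr_sumr; apply: eq_bigr => ax _; rewrite mulrA.
have eta0 : 0 < eta by rewrite divr_gt0.
have eta1 : eta <= 1 by rewrite /eta; lra.
exists ((eta, x) :: rescale (1 - eta) w); split.
- rewrite /nonneg_weights /= (ltW eta0); apply: nonneg_rescale => //.
  by rewrite subr_ge0.
- rewrite /total_weight big_cons -/(total_weight _) total_weight_rescale w1.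
  by rewrite mulr1 addrC subrK.
- move=> h g lh gE; rewrite !avgE -/eps.
  have := wE h g lh gE; have [h1 _] := lh.
  have := h1 (g * x)%g; have := h1 (1 * x)%g; rewrite !ler_norml.
  move=> /andP[a1 a2] /andP[b1 b2] /andP[c1 c2].
  have Ed : (1 - eta) * (average w h g - average w h 1%g) <= eps / 2.
    have [D0|D0] := leP 0 (average w h g - average w h 1%g); last nra.
    by rewrite (le_trans _ c2)// ler_piMl//; lra.
  have Eg : - (eps / 2) <= (1 - eta) * (average w h g - average w h 1%g).
    have [D0|D0] := leP 0 (average w h g - average w h 1%g); first by nra.
    rewrite (le_trans c1)// mulrBl mul1r lerBrDr gerDl.
    by rewrite mulr_ge0_le0 ?(ltW eta0) ?(ltW D0).
  have e1 : eta * h (g * x)%g <= eta by rewrite ler_piMr ?(ltW eta0).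
  have e2 : - eta <= eta * h (g * x)%g by rewrite -mulrN1 ler_pM2l.
  have e3 : eta * h (1 * x)%g <= eta by rewrite ler_piMr ?(ltW eta0).
  have e4 : - eta <= eta * h (1 * x)%g by rewrite -mulrN1 ler_pM2l.
  by move: e1 e2 e3 e4 Ed Eg; rewrite /eta; lra.
- by exists eta => //; rewrite mem_head.
Qed.

(* A walk that survives each step with probability 1 - 2^-i survives i 2^i   *)
(* steps with probability at most 1/(i+1).                                   *)
Definition test_points (d : nat -> G) (L : seq G) (i : nat) : seq G :=
  [seq (u * v)%g | u <- 1%g :: [seq d j | j <- iota 0 i.+1],
                   v <- words L (i * 2 ^ i)].

Lemma test_points_sub d L L' i i' : {subset L <= L'} -> (i <= i')%N ->
  {subset test_points d L i <= test_points d L' i'}.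
Proof.
move=> LL' ii' _ /allpairsP[[u v] /= [uI vL ->]]; apply: allpairs_f.
  move: uI; rewrite in_cons => /predU1P[->|uI]; first exact: mem_head.
  have /mapP[j jI ->] : u \in [seq d j | j <- iota 0 i.+1] := uI.
  rewrite in_cons map_f ?orbT// ; move: jI; rewrite !mem_iota /= !add0n => ji.
  exact: leq_trans ji _.
by apply: words_sub vL => //; apply: leq_mul => //; rewrite leq_exp2l.
Qed.

(** [L i] contains the atoms of all earlier [w j], so [w i] is almost invariant under long products
    of earlier increments, also when started from one of the first points of [d]. *)
Definition adapted (d : nat -> G) (w : nat -> seq (R * G)) (L : nat -> seq G) :=
  forall i, [/\ nonneg_weights (w i), total_weight (w i) = 1,
    forall h g, lipschitz1 countableG h -> g \in test_points d (L i) i ->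
      `|average (w i) h g - average (w i) h 1%g| <= i.+1%:R^-1,
    exists2 eta, 0 < eta & (eta, d i) \in w i &
    L i.+1 = L i ++ [seq ax.2 | ax <- w i]].

Lemma adapted_weights (d : nat -> G) : exists w L, adapted d w L.
Proof.
have [next nextP] := choice (fun p : nat * seq G =>
  almost_invariant_with_atom (test_points d p.2 p.1) (d p.1) p.1).
pose L := fix L i := if i is i'.+1 then L i' ++ [seq ax.2 | ax <- next (i', L i')]
  else [::].
exists (fun i => next (i, L i)), L => i.
by have [? ? ? ?] := nextP (i, L i); split.
Qed.

(** Induction, by (1 - x)(1 + (n+1) x) <= 1 + n x. *)
Lemma bernoulli_inv (x : R) n : 0 <= x <= 1 -> (1 - x) ^+ n <= (1 + n%:R * x)^-1.
Proof.
move=> /andP[x0 x1].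
have nx0 m : 0 < 1 + m%:R * x by rewrite ltr_wpDr// mulr_ge0.
rewrite -[leRHS]mul1r ler_pdivlMr//.
elim: n => [|n IH]; first by rewrite expr0 mul0r addr0 mul1r.
apply: le_trans IH; rewrite exprSr -mulrA ler_wpM2l ?exprn_ge0 ?subr_ge0//.
have : 0 <= (n%:R : R) by [].
rewrite -natr1; nra.
Qed.

Section estimate.
Variables (d : nat -> G) (w : nat -> seq (R * G)) (L : nat -> seq G).
Hypothesis wP : adapted d w L.

Let t i : R := 2^-1 ^+ i.+1.

Let t_ge0 i : 0 <= t i. Proof. by rewrite exprn_ge0// invr_ge0. Qed.

Let sum_t K : \sum_(i < K) t i = 1 - 2^-1 ^+ K.
Proof.
elim: K => [|K IH]; first by rewrite big_ord0 expr0 subrr.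
by rewrite big_ord_recr /= IH /t exprS; field.
Qed.

(** The contribution to [Phir mu f] of increments drawn from [w i] with i < K. Harmonicity enters
    this section as the convergence of these sums to [f]. *)
Definition partial_average K f u := \sum_(i < K) t i * average (w i) f u.

Let L_sub i j : (i <= j)%N -> {subset L i <= L j}.
Proof.
elim: j => [|j IH]; first by rewrite leqn0 => /eqP ->.
rewrite leq_eqVlt => /predU1P[->//|/IH ij x /ij xj].
by have [_ _ _ _ ->] := wP j; rewrite mem_cat xj.
Qed.

Let w_letter i K ax : (i < K)%N -> ax \in w i -> ax.2 \in L K.
Proof.
move=> iK axw; apply: (L_sub iK); have [_ _ _ _ ->] := wP i.
by rewrite mem_cat map_f ?orbT.
Qed.

Let average_cst i (c : R) u : average (w i) (fun=> c) u = c.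
Proof.
have [_ w1 _ _ _] := wP i; rewrite /average -mulr_suml.
by rewrite -/(total_weight _) w1 mul1r.
Qed.

Let average_dist i f1 f2 u1 u2 (r : R) : (forall ax, ax \in w i ->
    `|f1 (u1 * ax.2)%g - f2 (u2 * ax.2)%g| <= r) ->
  `|average (w i) f1 u1 - average (w i) f2 u2| <= r.
Proof.
move=> fr; have [/allP w0 w1 _ _ _] := wP i.
rewrite /average -sumrB (le_trans (ler_norm_sum _ _ _))//.
rewrite -[leRHS]mul1r -w1 /total_weight mulr_suml big_seq [leRHS]big_seq.
apply: ler_sum => ax axw; rewrite -mulrBr normrM ger0_norm ?w0//.
by rewrite ler_wpM2l ?w0// fr.
Qed.

Let average_approx i f h (C eps : R) u : lipschitz1 countableG h -> 0 < C ->
  (forall x, `|f x - C * h x| <= eps) -> u \in test_points d (L i) i ->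
  `|average (w i) f u - average (w i) f 1%g| <= 2 * eps + C / i.+1%:R.
Proof.
move=> lh C0 fh uE.
have avgC v : average (w i) (fun x => C * h x) v = C * average (w i) h v.
  by rewrite /average mulr_sumr; apply: eq_bigr => ax _; rewrite mulrCA.
have h1 v : `|average (w i) f v - C * average (w i) h v| <= eps.
  by rewrite -avgC; apply: average_dist => ax _; exact: fh.
have h2 : `|C * (average (w i) h u - average (w i) h 1%g)| <= C / i.+1%:R.
  by have [_ _ wE _ _] := wP i; rewrite normrM gtr0_norm// ler_wpM2l ?(ltW C0)// wE.
have := h1 u; have := h1 1%g; move: h2; rewrite mulrBr.
move: (C * _) (C * _) (C / _) (average _ f u) (average _ f 1%g) => p q r x y.
rewrite !ler_norml.
by move=> /andP[? ?] /andP[? ?] /andP[? ?]; apply/andP; split; lra.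
Qed.

Variables (f : G -> R) (M : R).
Hypotheses (fM : bounded_by f M)
  (hf : forall u, partial_average K f u @[K --> \oo] --> f u).

(** The remainder averages [f] over the [w i] with i >= K, of total mass 2^-K. Test points increase
    with i, so [u] is one for each of these. *)
Let remainder_dist K h (C eps : R) u : lipschitz1 countableG h -> 0 < C ->
  (forall x, `|f x - C * h x| <= eps) -> u \in test_points d (L K) K ->
  `|(f u - partial_average K f u) - (f 1%g - partial_average K f 1%g)| <=
    2^-1 ^+ K * (2 * eps + C / K.+1%:R).
Proof.
move=> lh C0 fh uE; pose r := 2 * eps + C / K.+1%:R.
have eps0 : 0 <= eps := le_trans (normr_ge0 _) (fh 1%g).
have r0 : 0 <= r.
  by apply: addr_ge0; [exact: mulr_ge0|apply: divr_ge0 => //; exact: ltW].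
have step m : `|(partial_average (K + m) f u - partial_average K f u) -
    (partial_average (K + m) f 1%g - partial_average K f 1%g)| <=
    (2^-1 ^+ K - 2^-1 ^+ (K + m)) * r.
  elim: m => [|m IH]; first by rewrite addn0 !subrr mul0r normr0.
  rewrite addnS /partial_average !big_ord_recr /= -!/(partial_average _ _ _).
  have -> : 2^-1 ^+ K - 2^-1 ^+ (K + m).+1 =
    (2^-1 ^+ K - 2^-1 ^+ (K + m)) + t (K + m) :> R.
    by rewrite /t [in LHS]exprS [in RHS]exprS; field.
  rewrite mulrDl; set A := partial_average _ f u; set B := partial_average _ f 1%g.
  have -> : A + t (K + m) * average (w (K + m)) f u - partial_average K f u -
     (B + t (K + m) * average (w (K + m)) f 1%g - partial_average K f 1%g) =
     (A - partial_average K f u - (B - partial_average K f 1%g)) +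
     t (K + m) * (average (w (K + m)) f u - average (w (K + m)) f 1%g) by ring.
  rewrite (le_trans (ler_normD _ _))// lerD// normrM ger0_norm// ler_wpM2l//.
  apply: (le_trans (average_approx lh C0 fh _)).
    by apply: test_points_sub uE; [exact/L_sub/leq_addr|exact: leq_addr].
  by rewrite lerD2l ler_pM2l// lef_pV2 ?posrE// ler_nat ltnS leq_addr.
have cvu v : partial_average (K + m) f v - partial_average K f v @[m --> \oo] -->
    f v - partial_average K f v.
  apply: cvgB; last exact: cvg_cst.
  exact: (cvg_comp _ _ (cvg_addnl K) (@hf v)).
apply: (cvgr_to_le (cvg_norm (cvgB (cvu u) (cvu 1%g)))).
apply: nearW => m; apply: (le_trans (step m)); rewrite ler_wpM2r//.
by rewrite lerBlDr lerDl exprn_ge0// invr_ge0.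
Qed.

(* Stop the random walk at the first of its first k steps drawn from some    *)
(* w i with i >= K: up to delta its value no longer depends on the start.    *)
Let stopping K (delta : R) k : 0 <= delta ->
  (forall u, u \in test_points d (L K) K ->
    `|(f u - partial_average K f u) - (f 1%g - partial_average K f 1%g)| <=
      2^-1 ^+ K * delta) ->
  exists kappa, forall u,
    (forall v, v \in words (L K) k -> (u * v)%g \in test_points d (L K) K) ->
    `|f u - kappa| <=
      (1 - 2^-1 ^+ K) ^+ k * M + (1 - (1 - 2^-1 ^+ K) ^+ k) * delta.
Proof.
move=> delta0 rem; elim: k => [|k [kappa IH]].
  by exists 0 => u _; rewrite subr0 expr0 mul1r subrr mul0r addr0.
pose s : R := 1 - 2^-1 ^+ K.
(* Increments from [w i] with i < K have mass [s] and lead to values near [kappa]; the remainder is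
   replaced by its value at 1. *)
exists (s * kappa + (f 1%g - partial_average K f 1%g)) => u uE.
pose r := s ^+ k * M + (1 - s ^+ k) * delta.
have uT : u \in test_points d (L K) K.
  by have := uE _ (words1 (L K) k.+1); rewrite mulg1.
have P1 : `|partial_average K f u - s * kappa| <= s * r.
  rewrite /s -sum_t !mulr_suml -sumrB (le_trans (ler_norm_sum _ _ _))//.
  apply: ler_sum => i _; rewrite -mulrBr normrM ger0_norm// ler_wpM2l//.
  rewrite -[X in _ - X](average_cst i kappa u); apply: average_dist => ax axw.
  apply: IH => v vk; rewrite -mulgA; apply: uE; apply: words_cons => //.
  exact: (w_letter (ltn_ord i)).
have := rem _ uT; rewrite -/s => P2.
have -> : f u - (s * kappa + (f 1%g - partial_average K f 1%g)) =
  (partial_average K f u - s * kappa) +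
  (f u - partial_average K f u - (f 1%g - partial_average K f 1%g)) by ring.
rewrite (le_trans (ler_normD _ _))// (le_trans (lerD P1 P2))//.
rewrite /r exprS (_ : 2^-1 ^+ K = 1 - s); last by rewrite /s subKr.
by rewrite le_eqVlt; apply/orP; left; apply/eqP; ring.
Qed.

(** Once K >= j, both [d j] and 1 are admissible starting points in [stopping], so both values of
    [f] are close to the same [kappa]. *)
Lemma harmonic_eq_at_dense j : rucbr f -> f (d j) = f 1%g.
Proof.
move=> rf; apply/eqP; rewrite -subr_eq0 -normr_le0; apply/ler_addgt0Pr => e e0.
rewrite add0r; have e8 : 0 < e / 8 by rewrite divr_gt0.
have M0 : 0 <= M by rewrite (le_trans _ (fM 1%g)).
have [h lh [C C0 fh]] := lipschitz1_dense countableG rf e8.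
have small (B : R) : 0 <= B -> \forall K \near \oo, B / K.+1%:R <= e / 8.
  move=> B0; have B1 : 0 < e / 8 / (B + 1) by rewrite divr_gt0// ltr_wpDl.
  apply: filterS (near_infty_natSinv_lt (PosNum B1)) => n /= /ltW nB.
  apply: (@le_trans _ _ ((B + 1) * (e / 8 / (B + 1)))).
    by rewrite ler_pM// ?lerDl// invr_ge0.
  by rewrite mulrC divfK// gt_eqF// ltr_wpDl.
near \oo => K.
have jK : (j <= K)%N by near: K; exact: nbhs_infty_ge.
have CK : C / K.+1%:R <= e / 8 by near: K; exact: small (ltW C0).
have MK : M / K.+1%:R <= e / 8 by near: K; exact: small M0.
(* Twice the approximation error e/8, plus C/(K+1) <= e/8. *)
pose delta := 3 * (e / 8).
have delta0 : 0 <= delta by rewrite mulr_ge0// ltW.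
have rem u : u \in test_points d (L K) K ->
    `|(f u - partial_average K f u) - (f 1%g - partial_average K f 1%g)| <=
      2^-1 ^+ K * delta.
  move=> /(remainder_dist lh C0 fh) /le_trans; apply.
  rewrite ler_wpM2l ?exprn_ge0 ?invr_ge0// /delta.
  by move: (C / _) CK => r; lra.
have [kappa kappaP] := stopping (K * 2 ^ K) delta0 rem.
set s : R := (1 - 2^-1 ^+ K) ^+ (K * 2 ^ K) in kappaP.
have half01 : 0 <= (2^-1 ^+ K : R) <= 1.
  by rewrite exprn_ge0 ?invr_ge0// exprn_ile1// ?invr_ge0// invf_le1// ler1n.
have s0 : 0 <= s by rewrite exprn_ge0// subr_ge0; case/andP: half01.
have sK : s <= K.+1%:R^-1.
  apply: (le_trans (bernoulli_inv _ half01)).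
  rewrite natrM natrX exprVn mulfK ?expf_neq0 ?pnatr_eq0//.
  by rewrite -natr1 addrC.
(* Surviving all steps contributes s M <= e/8 and stopping at most delta = 3e/8. *)
have bound u : u \in 1%g :: [seq d j | j <- iota 0 K.+1] ->
    `|f u - kappa| <= e / 2.
  move=> uI; apply: (le_trans (kappaP u _)).
    by move=> v vW; exact: allpairs_f.
  have : s * M <= e / 8.
    by rewrite (le_trans _ MK)// mulrC ler_wpM2l.
  have : (1 - s) * delta <= delta by rewrite ler_piMl// gerBl.
  by rewrite /delta; lra.
have dj : d j \in 1%g :: [seq d j | j <- iota 0 K.+1].
  by rewrite inE map_f ?orbT// mem_iota /= add0n ltnS.
have := bound _ dj; have := bound _ (mem_head _ _); rewrite !ler_norml.
by move=> /andP[? ?] /andP[? ?]; apply/andP; split; lra.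
Unshelve. all: by end_near. Qed.

End estimate.

Lemma amenable_liouville : hausdorff_space G ->
  exists mu : probability (borel G) R,
  [/\ fully_supported mu, regular_measure mu &
   forall f, rucbr f -> Phir mu f = f -> forall g h, f g = f h].
Proof.
move=> hG; have [d dd] := dense_sequence countableG.
have [w [L wP]] := adapted_weights d.
pose v i := rescale (2^-1 ^+ i.+1 : R) (w i).
have v0 i : v i != [::].
  have [_ _ _ [eta _ +] _] := wP i.
  by rewrite /v /rescale; case: (w i).
(* All weighted atoms in one sequence, block i listing those of 2^-(i+1) times [w i]. *)
have [e [sz [szK eE]]] := enumerate_blocks (1, 1%g) v0.
have half0 i : 0 < (2^-1 ^+ i.+1 : R) by rewrite exprn_gt0// invr_gt0.
have sumE K (F : G -> R) : \sum_(n < sz K) (e n).1 * F (e n).2 =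
    \sum_(i < K) 2^-1 ^+ i.+1 * \sum_(ax <- w i) ax.1 * F ax.2.
  rewrite -(big_mkord xpredT (fun n => (e n).1 * F (e n).2)) /index_iota subn0.
  rewrite -(big_map e xpredT (fun bx => bx.1 * F bx.2)) eE big_flatten big_map.
  rewrite -(big_mkord xpredT (fun i =>
    2^-1 ^+ i.+1 * \sum_(ax <- w i) ax.1 * F ax.2)).
  rewrite /index_iota subn0; apply: eq_bigr => i _.
  by rewrite /v /rescale big_map mulr_sumr; apply: eq_bigr => ax _; rewrite mulrA.
have e_in n : exists i, e n \in v i.
  have : e n \in [seq e n | n <- iota 0 (sz n.+1)].
    by apply: map_f; rewrite mem_iota /= add0n szK.
  by rewrite eE => /flattenP[s /mapP[i _ ->]]; exists i.
have e0 n : 0 <= (e n).1.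
  have [i /mapP[ax axw ->]] := e_in n; have [/allP w0 _ _ _ _] := wP i.
  by rewrite /= mulr_ge0 ?(ltW (half0 _))// w0.
have sum1 K : \sum_(n < sz K) (e n).1 = 1 - 2^-1 ^+ K.
  have := sumE K (fun=> 1); under eq_bigr do rewrite mulr1.
  move=> ->; elim: K => [|K IH]; first by rewrite big_ord0 expr0 subrr.
  rewrite big_ord_recr /= IH; under eq_bigr do rewrite mulr1.
  have [_ + _ _ _] := wP K; rewrite /total_weight => ->.
  by rewrite exprS; field.
have mono m n : (m <= n)%N -> \sum_(k < m) (e k).1 <= \sum_(k < n) (e k).1.
  move=> mn; rewrite -!(big_mkord xpredT (fun k => (e k).1)).
  rewrite [leRHS](big_cat_nat (leq0n m) mn) /=.
  by rewrite lerDl sumr_ge0.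
pose c n : {nonneg R} := NngNum (e0 n).
have half_cvg : (2^-1 ^+ K : R) @[K --> \oo] --> (0 : R).
  by apply: cvg_expr; rewrite gtr0_norm ?invr_gt0// invf_lt1// ltr1n.
have c1 : \sum_(k < n) (c k)%:num @[n --> \oo] --> (1 : R).
  apply/cvgrPdist_le => eps eps0.
  have /cvgrPdist_le/(_ _ eps0)[K _ KP] := half_cvg.
  exists (sz K) => // n /= szn.
  have l1 := mono _ _ szn; have l2 := mono _ _ (szK n); rewrite !sum1 in l1 l2.
  have := KP K (leqnn K); rewrite /= sub0r normrN.
  have hn : 0 <= (2^-1 ^+ n : R) by rewrite exprn_ge0// invr_ge0.
  have hK : 0 <= (2^-1 ^+ K : R) by rewrite exprn_ge0// invr_ge0.
  by rewrite (ger0_norm hK) ger0_norm; lra.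
have [mu [muE muI]] := atomic_probability (fun n => (e n).2) c1.
exists mu; split; last first.
- move=> f rf hf.
  have [[M fM] _] := rf.
  (* These are the partial sums at [sz K], which tends to infinity, of the series for
     [Phir mu f u = f u]. *)
  have cvP u : partial_average w K f u @[K --> \oo] --> f u.
    have := muI f rf u; rewrite hf => fu.
    have sz_oo : sz K @[K --> \oo] --> \oo.
      move=> A [n _ nA]; exists n => // K /= nK; apply: nA => /=.
      exact: leq_trans nK (szK K).
    rewrite (_ : (fun K => _) = fun K =>
      \sum_(n < sz K) (e n).1 * f (u * (e n).2)%g); last first.
      by apply/funext => K; rewrite (sumE K (fun y => f (u * y)%g)).
    exact: (cvg_comp _ _ sz_oo fu).
  have fd j : f (d j) = f 1%g := harmonic_eq_at_dense wP fM cvP j rf.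
  (* Constancy on the dense sequence extends to G by continuity. *)
  suff f1 x : f x = f 1%g by move=> g h; rewrite !f1.
  apply/eqP; apply: contrapT => /negP fx.
  have fx0 : 0 < `|f x - f 1%g| by rewrite normr_gt0 subr_eq0.
  have : nbhs x [set y | `|f x - f y| < `|f x - f 1%g|].
    have fy : f y @[y --> x] --> f x by exact: rucbr_continuous.
    by move/cvgrPdist_lt : fy; apply.
  rewrite nbhsE => -[U [oU Ux] UP].
  have [|i Ui] := dd U oU; first by exists x.
  by have := UP _ Ui; rewrite /= fd ltxx.
- exact: (@atomic_regular _ _ c (fun n => (e n).2) mu muE hG).
- apply/seteqP; split=> // x _ U oU Ux.
  have [|i Ui] := dd U oU; first by exists x.
  have [_ _ _ [eta eta0 dw] _] := wP i.
  have : (2^-1 ^+ i.+1 * eta, d i) \in [seq e n | n <- iota 0 (sz i.+1)].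
    rewrite eE; apply/flattenP; exists (v i).
      by apply: map_f; rewrite mem_iota /= add0n.
    by apply/mapP; exists (eta, d i).
  move=> /mapP[n _ en]; apply: (@atomic_gt0 _ _ c (fun n => (e n).2) mu muE n).
    by rewrite /c /= -en /= mulr_gt0.
  by rewrite /= -en.
Qed.

End liouville_measure.

Theorem corollary4p8 (R : realType) (G : topologicalGroupType)
    (hausdorffG : hausdorff_space G) (countableG : @second_countable G) :
  (amenable R G <->
   exists mu : probability (borel G) R,
     [/\ fully_supported mu, regular_measure mu & trivial_poisson_boundary mu])
  /\
  (amenable R G <->
   exists mu : probability (borel G) R, trivial_poisson_boundary mu).
Proof.
have construct : amenable R G -> exists mu : probability (borel G) R,
    [/\ fully_supported mu, regular_measure mu & trivial_poisson_boundary mu].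
  move=> amG; have [mu [fs rg hc]] := amenable_liouville countableG amG hausdorffG.
  by exists mu; split=> //; exact: harmonic_cst_trivial_boundary.
have amen : (exists mu : probability (borel G) R, trivial_poisson_boundary mu) ->
    amenable R G.
  move=> [mu tb]; apply: (liouville_amenable countableG (mu := mu)).
  exact: trivial_boundary_harmonic.
split; split=> //.
- by move=> [mu [_ _ tb]]; apply: amen; exists mu.
- by move=> /construct[mu [_ _ tb]]; exists mu.
Qed.
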